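(* Let $\star\in\{{\rm ABS},{\rm NOR}\}$. (i) For every $\omega>0$ there is a constant $C_\omega>0$ depending only on $\omega$ such that for all $d\in\mathbb N$ and all $\varepsilon\in(0,1)$, $$n^{\star}(\varepsilon,d;\Lambda^{\rm std})\le C_\omega\Big(n^{\star}(\varepsilon/4,d;\Lambda^{\rm all})+1\Big)^{1+\omega}.$$ (ii) For all sufficiently small $\omega>0$ and $\delta>0$ there is a constant $C_{\omega,\delta}>0$ depending only on $\omega,\delta$ such that for all $d\in\mathbb N$ and $\varepsilon\in(0,1)$, $$n^{\star}(\varepsilon,d;\Lambda^{\rm std})\le C_{\omega,\delta}\Big(n^{\star}(\varepsilon/A_\delta,d;\Lambda^{\rm all})+1\Big)^{1+\omega},\qquad A_\delta:=\Big(1+\frac{1}{12\ln(1/\delta)}\Big)^{1/2}\frac{1}{\sqrt{1-\delta}}.$$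
   Context: Setting (average case approximation). For each $d\in\mathbb N$: $D_d\subset\mathbb R^d$ is a Borel set of positive Lebesgue measure, $\rho_d$ is a probability density on $D_d$, and $G_d=L_2(D_d,\rho_d(x)\,dx)$. $F_d$ is a separable Banach space of real-valued functions on $D_d$, continuously embedded in $G_d$, such that every point evaluation $f\mapsto f(x)$, $x\in D_d$, is a continuous linear functional on $F_d$; $F_d$ carries a zero-mean Gaussian measure $\mu_d$. ${\rm APP}_d:F_d\to G_d$, ${\rm APP}_d f=f$. $\Lambda^{\rm all}$ is the class of all continuous linear functionals on $F_d$, $\Lambda^{\rm std}$ the class of point evaluations. For $\Lambda\in\{\Lambda^{\rm all},\Lambda^{\rm std}\}$, an algorithm is $A_{n,d}f=\phi_{n,d}(L_1(f),\dots,L_n(f))$ with $L_i\in\Lambda$ and $\phi_{n,d}:\mathbb R^n\to G_d$ measurable; its average case error is $e^{\rm avg}(A_{n,d})=\big(\int_{F_d}\|f-A_{n,d}f\|_{G_d}^2\,\mu_d(df)\big)^{1/2}$, and $e^{\rm avg}(n,d;\Lambda)$ is the infimum of $e^{\rm avg}(A_{n,d})$ over all such algorithms using $n$ functionals from $\Lambda$ (for $n=0$, $A_{0,d}=0$). Set $\Gamma_d=(e^{\rm avg}(0,d;\Lambda))^2$ (same for both classes). Information complexity: for $\varepsilon>0$, $n^{\star}(\varepsilon,d;\Lambda)=\min\{n\ge0:\ e^{\rm avg}(n,d;\Lambda)\le\varepsilon\,{\rm CRI}_d\}$, where ${\rm CRI}_d=1$ for $\star={\rm ABS}$ (absolute error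 criterion) and ${\rm CRI}_d=\sqrt{\Gamma_d}$ for $\star={\rm NOR}$ (normalized error criterion). *)

(* Defs.v *)
From HB Require Import structures.
From mathcomp Require Import all_boot all_order all_algebra.
From mathcomp Require Import all_classical all_reals all_analysis.
Set Implicit Arguments. Unset Strict Implicit. Unset Printing Implicit Defensive.
Import Order.TTheory GRing.Theory Num.Theory.
Import numFieldNormedType.Exports.
Local Open Scope classical_set_scope.
Local Open Scope ring_scope.

Definition borel (T : topologicalType) := g_sigma_algebraType (@open T).

Section setting.
Context {R : realType}.

(** Lebesgue measure on R^d (= d.-tuple R with the product/Borel sigma-algebra):
    characterised by its values on closed boxes (it is unique). *)
Definition box d (a b : d.-tuple R) : set (d.-tuple R) :=
  [set x | forall i, tnth a i <= tnth x i <= tnth b i].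

Definition is_lebesgue d (lam : {measure set (d.-tuple R) -> \bar R}) : Prop :=
  forall a b : d.-tuple R,
    lam (box a b) = (\prod_(i < d) Num.max (tnth b i - tnth a i) 0)%:E.

Definition G_norm2 d (lam : {measure set (d.-tuple R) -> \bar R})
  (D : set (d.-tuple R)) (rho : d.-tuple R -> R) (g : d.-tuple R -> R) : \bar R :=
  (\int[lam]_(x in D) ((g x) ^+ 2 * rho x)%:E)%E.

Definition lin_fun (V : normedModType R) (L : V -> R) : Prop :=
  forall (a : R) (u v : V), L (a *: u + v) = a * L u + L v.

Definition gauss1 (s : R) (A : set R) : \bar R :=
  if s == 0 then \d_(0 : R) A else normal_prob 0 s A.
End setting.

Inductive info_class := Lall | Lstd.
Inductive criterion := ABS | NOR.

Section avg.
Local Open Scope ereal_scope.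
Context {R : realType} {d : nat} (lam : {measure set (d.-tuple R) -> \bar R})
  (D : set (d.-tuple R)) (rho : d.-tuple R -> R)
  {V : normedModType R} (ev : V -> d.-tuple R -> R)
  (mu : probability (borel V) R).

Definition in_class (c : info_class) (L : V -> R) : Prop :=
  match c with
  | Lall => lin_fun L /\ continuous L
  | Lstd => exists x, D x /\ L = (fun f => ev f x)
  end.

(** measurability of phi : R^n -> G_d, expressed as joint measurability of (y, x) |-> phi y x *)
Definition meas_phi n (phi : n.-tuple R -> d.-tuple R -> R) : Prop :=
  measurable_fun [set: (n.-tuple R * d.-tuple R)%type] (fun p => phi p.1 p.2).

Definition err2 n (L : 'I_n -> V -> R) (phi : n.-tuple R -> d.-tuple R -> R) : \bar R :=
  \int[mu]_f G_norm2 lam D rho (fun x => (ev f x - phi [tuple L i f | i < n] x)%R).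

Definition Gamma : \bar R := \int[mu]_f G_norm2 lam D rho (ev f).

(** e^avg(n, d; Lambda) ; for n = 0 the algorithm is A = 0 *)
Definition e_avg (c : info_class) (n : nat) : \bar R :=
  if n == 0%N then sqrte Gamma
  else ereal_inf [set r | exists (L : 'I_n -> V -> R) (phi : n.-tuple R -> d.-tuple R -> R),
                            (forall i, in_class c (L i)) /\ meas_phi phi /\
                            r = sqrte (err2 L phi)].

Definition CRI (crit : criterion) : \bar R :=
  match crit with ABS => 1 | NOR => sqrte Gamma end.

Definition is_nstar (crit : criterion) (c : info_class) (eps : R) (m : nat) : Prop :=
  e_avg c m <= eps%:E * CRI crit /\
  forall k, e_avg c k <= eps%:E * CRI crit -> (m <= k)%N.

Definition setting_ok : Prop :=
  is_lebesgue lam /\ measurable D /\ 0 < lam D /\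
  (measurable_fun D rho /\ (forall x, D x -> (0 <= rho x)%R) /\
     \int[lam]_(x in D) (rho x)%:E = 1) /\
  (exists S : set V, countable S /\ closure S = setT) /\
  (* F_d is a linear space of functions on D_d *)
  (forall (a : R) (f g : V) x, ev (a *: f + g)%R x = (a * ev f x + ev g x)%R) /\
  (forall f g : V, (forall x, D x -> ev f x = ev g x) -> f = g) /\
  (forall x, D x -> continuous (fun f : V => ev f x)) /\
  (* continuous embedding F_d -> G_d *)
  ((forall f, measurable_fun D (ev f)) /\
   (exists C : R, forall f, G_norm2 lam D rho (ev f) <= ((C * `|f|) ^+ 2)%:E) /\
   (forall f, G_norm2 lam D rho (ev f) = 0 -> f = 0%R)) /\
  (* mu is a zero-mean Gaussian measure on F_d *)
  (forall L : V -> R, lin_fun L -> continuous L ->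
     exists s : R, (0 <= s)%R /\
       forall A : set R, measurable A -> mu (L @^-1` A) = gauss1 s A).
End avg.

Definition A_delta {R : realType} (delta : R) : R :=
  Num.sqrt (1 + 1 / (12 * ln (1 / delta))) * (1 / Num.sqrt (1 - delta)).

(* Main.v *)
Require Import Defs.
From HB Require Import structures.
From mathcomp Require Import all_boot all_order all_fingroup all_algebra.
From mathcomp Require Import all_classical all_reals all_analysis.
From mathcomp Require Import measurable_realfun normal_distribution.
From mathcomp Require Import ring lra.
Set Implicit Arguments. Unset Strict Implicit. Unset Printing Implicit Defensive.
Import Order.TTheory GRing.Theory Num.Theory.
Import numFieldNormedType.Exports.
Local Open Scope classical_set_scope.
Local Open Scope ring_scope.

(** The average case error splits over the nodes by Tonelli. Gaussianity
    (through the Cramer-Wold device) shows that no algorithm using m linear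
    functionals beats the L2(rho) projection onto some span of p <= m functions
    eta_j, so only the coefficients <f, eta_j> have to be recovered from samples.
    Interpolation at p Fekete points, weighted by the remainder, recovers them
    up to a factor 4 p^2 in the squared error. Each Monte Carlo correction with
    n nodes drawn from the density (1/p) sum_j eta_j^2 then multiplies the error
    in the coefficients by p/n, relative to the total error, and the nodes can be
    chosen one by one; with n of order m^(1 + omega), a number of corrections
    depending only on omega brings this error below any fixed fraction of the
    optimal one. *)

(** * Square integrable functions and their inner product *)

Section square_integrable.
Context d (T : measurableType d) (R : realType) (P : {measure set T -> \bar R}).
Implicit Types f g h : T -> R.

(** Both parts of the theorem are one statement with an arbitrary factor A > 1 in place of 4 and
    [A_delta]: sampling exceeds the squared error of the projection by at most th times any S above
    a near-optimal squared error, with th as small as desired, so A > 1 absorbs this excess together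
    with the gap between an infimum and a near-minimizer. The corrections cannot start from the zero
    algorithm: its coefficient error may exceed the projection error by any factor, while one
    correction gains only p/n. The Fekete start is polynomial in p relative to the projection error,
    which fixes the number of corrections: with M = m + 1 and n of order M^(1 + omega), each gains
    M^(-omega), and 2/omega of them beat M^2. Independence of the nodes is replaced by additivity: a
    suitable next node raises the second moment of the accumulated error by at most p times the
    total error, so n nodes cost n and not n^2 such terms. The [eta] come from covariances of
    function values with the given functionals, not from eigenfunctions, so arbitrary functionals
    are treated directly. *)

Definition sqint f := measurable_fun setT f /\ (\int[P]_x (f x ^+ 2)%:E < +oo)%E.

(** Functions are kept as such, not as classes modulo null sets, because they are evaluated at
    nodes. [Rintegral] makes the value real; it is meaningful on [sqint] arguments. *)
Definition dotp f g : R := \int[P]_x (f x * g x).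

Lemma sqint_mul f g : sqint f -> sqint g -> P.-integrable setT (EFin \o (fun x => f x * g x)).
Proof.
move=> [mf If] [mg Ig]; apply/integrableP; split.
  by apply/measurable_EFinP; exact: measurable_funM.
have le2 : (\int[P]_x ((f x ^+ 2)%:E + (g x ^+ 2)%:E) < +oo)%E.
  rewrite ge0_integralD//.
  - by rewrite lte_add_pinfty.
  - by move=> x _; rewrite lee_fin sqr_ge0.
  - by apply/measurable_EFinP; exact: measurable_funX.
  - by move=> x _; rewrite lee_fin sqr_ge0.
  - by apply/measurable_EFinP; exact: measurable_funX.
apply: le_lt_trans le2; apply: ge0_le_integral => //.
- by apply/measurable_EFinP; apply: measurableT_comp => //; exact: measurable_funM.
- by apply: emeasurable_funD; apply/measurable_EFinP; exact: measurable_funX.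
- move=> x _ /=; rewrite -EFinD lee_fin normrM.
  rewrite -(real_normK (num_real (f x))) -(real_normK (num_real (g x))).
  by have := sqr_ge0 (`|f x| - `|g x|); have := sqr_ge0 (`|f x|); have := sqr_ge0 (`|g x|); nra.
Qed.

Lemma sqint_integrable2 f : sqint f -> P.-integrable setT (EFin \o (fun x => f x ^+ 2)).
Proof. by move=> sf; have := sqint_mul sf sf. Qed.

Lemma integral_sqr f : sqint f -> (\int[P]_x (f x ^+ 2)%:E = (dotp f f)%:E)%E.
Proof.
move=> sf; rewrite /dotp /Rintegral fineK.
  by apply: eq_integral => x _; rewrite expr2.
exact: integrable_fin_num (sqint_mul sf sf).
Qed.

Lemma sqint0 : sqint (fun _ => 0).
Proof.
split; first exact: measurable_cst.
by under eq_integral do rewrite expr0n /=; rewrite integral0.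
Qed.

Lemma sqintZ a f : sqint f -> sqint (fun x => a * f x).
Proof.
move=> sf; split; first by apply: measurable_funM => //; case: sf.
under eq_integral do rewrite exprMn EFinM.
rewrite ge0_integralZl//.
- by rewrite lte_mul_pinfty ?lee_fin ?sqr_ge0//; case: sf.
- by apply/measurable_EFinP; apply: measurable_funX; case: sf.
- by move=> x _; rewrite lee_fin sqr_ge0.
- by rewrite lee_fin sqr_ge0.
Qed.

Lemma sqintD f g : sqint f -> sqint g -> sqint (fun x => f x + g x).
Proof.
move=> sf sg; split; first by apply: measurable_funD; [case: sf|case: sg].
have I : P.-integrable setT
    (EFin \o (fun x => f x ^+ 2 + 2 * (f x * g x) + g x ^+ 2)).
  have E : (EFin \o (fun x => f x ^+ 2 + 2 * (f x * g x) + g x ^+ 2)) =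
    ((EFin \o (fun x => f x ^+ 2)%R) \+ (fun x => 2%:E * (EFin \o (fun x => f x * g x)%R) x)
      \+ (EFin \o (fun x => g x ^+ 2)%R))%E by [].
  rewrite E; apply: integrableD => //; last exact: sqint_integrable2.
  apply: integrableD => //; first exact: sqint_integrable2.
  by apply: integrableZl => //; exact: sqint_mul.
move/integrableP : I => [_]; congr (_ < _)%E; apply: eq_integral => x _ /=.
rewrite ger0_norm; first by congr EFin; ring.
by have := sqr_ge0 (f x + g x); rewrite sqrrD; nra.
Qed.

Lemma eq_sqint f g : f =1 g -> sqint f -> sqint g.
Proof. by move=> /funext ->. Qed.

Lemma sqint_lin n (a : 'I_n -> R) (f : 'I_n -> T -> R) :
  (forall i, sqint (f i)) -> sqint (fun x => \sum_i a i * f i x).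
Proof.
move=> sf; elim: n a f sf => [|n IH] a f sf.
  by apply: eq_sqint sqint0 => x; rewrite big_ord0.
apply: (@eq_sqint (fun x => \sum_(i < n) a (widen_ord (leqnSn n) i) *
    f (widen_ord (leqnSn n) i) x + a ord_max * f ord_max x)).
  by move=> x; rewrite big_ord_recr.
by apply: sqintD; [exact: IH|exact: sqintZ].
Qed.

Lemma sqintN f : sqint f -> sqint (fun x => - f x).
Proof.
by move=> /(sqintZ (-1)); apply: eq_sqint => x; rewrite mulN1r.
Qed.

Lemma sqintB f g : sqint f -> sqint g -> sqint (fun x => f x - g x).
Proof. by move=> sf sg; apply: sqintD => //; exact: sqintN. Qed.

Lemma dotpC f g : dotp f g = dotp g f.
Proof. by apply: eq_Rintegral => x _; rewrite mulrC. Qed.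

Lemma dotp_ge0 f : 0 <= dotp f f.
Proof. by apply: Rintegral_ge0 => x _; rewrite -expr2 sqr_ge0. Qed.

Lemma dotpDl f g h : sqint f -> sqint g -> sqint h ->
  dotp (fun x => f x + g x) h = dotp f h + dotp g h.
Proof.
move=> sf sg sh; rewrite /dotp -RintegralD//; [|exact: sqint_mul..].
by apply: eq_Rintegral => x _; rewrite mulrDl.
Qed.

Lemma dotpZl a f h : sqint f -> sqint h -> dotp (fun x => a * f x) h = a * dotp f h.
Proof.
move=> sf sh; rewrite /dotp -RintegralZl//; last exact: sqint_mul.
by apply: eq_Rintegral => x _; rewrite mulrA.
Qed.

Lemma dotpNl f h : sqint f -> sqint h -> dotp (fun x => - f x) h = - dotp f h.
Proof.
move=> sf sh; rewrite -mulN1r -dotpZl//.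
by apply: eq_Rintegral => x _; rewrite mulN1r.
Qed.

Lemma dotpBl f g h : sqint f -> sqint g -> sqint h ->
  dotp (fun x => f x - g x) h = dotp f h - dotp g h.
Proof. by move=> sf sg sh; rewrite dotpDl ?dotpNl//; exact: sqintN. Qed.

Lemma dotp_suml n (a : 'I_n -> R) (f : 'I_n -> T -> R) h :
  (forall i, sqint (f i)) -> sqint h ->
  dotp (fun x => \sum_i a i * f i x) h = \sum_i a i * dotp (f i) h.
Proof.
move=> sf sh; elim: n a f sf => [|n IH] a f sf.
  rewrite big_ord0 /dotp.
  under eq_Rintegral do rewrite big_ord0 mul0r.
  by rewrite Rintegral_cst// mul0r.
rewrite big_ord_recr/= -IH// -dotpZl// -dotpDl//; last 2 first.
  exact: sqint_lin.
  exact: sqintZ.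
by apply: eq_Rintegral => x _; rewrite big_ord_recr.
Qed.

Lemma dotpBB f g : sqint f -> sqint g ->
  dotp (fun x => f x - g x) (fun x => f x - g x) = dotp f f - 2 * dotp f g + dotp g g.
Proof.
move=> sf sg; have sB := sqintB sf sg.
rewrite dotpBl// dotpC (dotpC g) !dotpBl// (dotpC g f); ring.
Qed.

Lemma dotpDD f g : sqint f -> sqint g ->
  dotp (fun x => f x + g x) (fun x => f x + g x) = dotp f f + 2 * dotp f g + dotp g g.
Proof.
move=> sf sg; have sB := sqintD sf sg.
rewrite dotpDl// dotpC (dotpC g) !dotpDl// (dotpC g f); ring.
Qed.

Lemma dotp0_ae f : sqint f -> dotp f f = 0 -> {ae P, forall x, f x = 0}.
Proof.
move=> sf f0; have := integral_sqr sf; rewrite f0 => I0.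
have : (\int[P]_x `| (f x ^+ 2)%:E | = 0)%E.
  by rewrite -[RHS]I0; apply: eq_integral => x _; rewrite gee0_abs// lee_fin sqr_ge0.
move/ae_eq_integral_abs => /(_ measurableT).
have mf2 : measurable_fun setT (fun x => (f x ^+ 2)%:E).
  by apply/measurable_EFinP; apply: measurable_funX; case: sf.
move=> /(_ mf2); apply: filterS => x /(_ Logic.I) /= [] /eqP.
by rewrite sqrf_eq0 => /eqP.
Qed.

Lemma dotp_ae f g f' g' : sqint f -> sqint g -> sqint f' -> sqint g' ->
  {ae P, forall x, f x = f' x} -> {ae P, forall x, g x = g' x} -> dotp f g = dotp f' g'.
Proof.
move=> sf sg sf' sg' ff' gg'; rewrite /dotp /Rintegral; congr fine.
apply: ae_eq_integral => //.
- by apply/measurable_EFinP; apply: measurable_funM; [case: sf|case: sg].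
- by apply/measurable_EFinP; apply: measurable_funM; [case: sf'|case: sg'].
- by apply: filterS2 ff' gg' => x -> ->.
Qed.

End square_integrable.

(** * Gram matrices, spanning rows and Fekete points *)

Section linear_algebra.
Context {R : realType}.

Definition psd n (G : 'M[R]_n) := G^T = G /\ forall v : 'rV[R]_n, 0 <= (v *m G *m v^T) 0 0.

Lemma psd_congr n r (G : 'M[R]_n) (Q : 'M[R]_(r, n)) : psd G -> psd (Q *m G *m Q^T).
Proof.
move=> [Gs Gp]; split; first by rewrite !trmx_mul trmxK Gs mulmxA.
by move=> v; have := Gp (v *m Q); rewrite trmx_mul !mulmxA.
Qed.

Lemma psd_delta n (G : 'M[R]_n) i j :
  ((delta_mx 0 i : 'rV_n) *m G *m (delta_mx 0 j : 'rV_n)^T) 0 0 = G i j.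
Proof. by rewrite -rowE trmx_delta -colE !mxE. Qed.

Lemma psd_diag n (G : 'M[R]_n) i : psd G -> 0 <= G i i.
Proof. by move=> [_ /(_ (delta_mx 0 i))]; rewrite psd_delta. Qed.

(** On the vector e_i + t e_j the form takes the value 2 t G_ij; both t = 1 and t = -1 must give a
    nonnegative number. *)
Lemma psd_diag0 n (G : 'M[R]_n) : psd G -> (forall i, G i i = 0) -> G = 0.
Proof.
move=> [Gs Gp] G0; apply/matrixP => i j; rewrite [RHS]mxE.
have Gij : G j i = G i j by rewrite -[in LHS]Gs mxE.
have H t : 0 <= 2 * t * G i j.
  have := Gp (delta_mx 0 i + t *: delta_mx 0 j).
  have -> : (delta_mx 0 i + t *: delta_mx 0 j : 'rV_n)^T =
     (delta_mx 0 i : 'rV_n)^T + t *: (delta_mx 0 j : 'rV_n)^T.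
    by apply/matrixP => a b; rewrite !mxE.
  rewrite !(mulmxDl, mulmxDr) -!(scalemxAl, scalemxAr).
  have E (A B : 'M[R]_1) : (A + B) 0 0 = A 0 0 + B 0 0 by rewrite mxE.
  have Z a (B : 'M[R]_1) : (a *: B) 0 0 = a * B 0 0 by rewrite mxE.
  by rewrite !(E, Z) !psd_delta !G0 Gij; lra.
by have := H 1; have := H (-1); lra.
Qed.

(** A Gram-Schmidt step. [Q] projects onto the [G]-orthogonal complement of the rows of [P]; the
    residual form [Q *m G *m Q^T] is nonzero, so by [psd_diag0] it has a positive diagonal entry,
    and the corresponding row of [Q] is normalized. *)
Lemma orthonormal_extend n r (G : 'M[R]_n) (P : 'M[R]_(r, n)) :
  psd G -> P *m G *m P^T = 1%:M -> G *m P^T *m P *m G != G ->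
  exists v : 'rV[R]_n, v *m G *m P^T = 0 /\ v *m G *m v^T = 1%:M.
Proof.
move=> pG P1 R0; have Gs : G^T = G by case: pG.
pose Q := 1%:M - G *m P^T *m P.
have QGP : Q *m G *m P^T = 0.
  by rewrite /Q mulmxBl mul1mx mulmxBl -!mulmxA (mulmxA P G) P1 mulmx1 subrr.
have GQ : Q *m G *m Q^T = G - G *m P^T *m P *m G.
  rewrite {2}/Q linearB /= trmx1 mulmxBr mulmx1 !trmx_mul trmxK Gs.
  by rewrite !mulmxA QGP !mul0mx subr0 /Q mulmxBl mul1mx.
have [i Ri] : exists i, (Q *m G *m Q^T) i i != 0.
  apply: contrapT => /forallNP N; move: R0; rewrite eq_sym -subr_eq0 -GQ => /eqP; apply.
  by apply: psd_diag0 => [|i]; [exact: psd_congr|apply/eqP; have /negP := N i; rewrite negbK].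
have Rp : 0 < (Q *m G *m Q^T) i i.
  by rewrite lt_neqAle eq_sym Ri psd_diag//; exact: psd_congr.
pose s := Num.sqrt ((Q *m G *m Q^T) i i).
have s0 : 0 < s by rewrite sqrtr_gt0.
exists (s^-1 *: row i Q); split.
  by rewrite -!scalemxAl -!row_mul QGP row0 scaler0.
have -> : (s^-1 *: row i Q)^T = s^-1 *: (row i Q)^T by apply/matrixP => a b; rewrite !mxE.
rewrite -!scalemxAl -scalemxAr scalerA; apply/matrixP => a b; rewrite !ord1 !mxE.
have -> : \sum_j (row i Q *m G) 0 j * (row i Q)^T j 0 = s ^+ 2.
  rewrite sqr_sqrtr ?ltW// -row_mul [RHS]mxE; apply: eq_bigr => j _.
  by rewrite !mxE.
by rewrite eqxx -invfM -expr2 mulVf// expf_neq0// gt_eqF.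
Qed.

(* The last equation says that the rows of [P] span everything modulo the
   radical of the form [G]. *)
Lemma gram_orthonormalization n (G : 'M[R]_n) : psd G ->
  exists r (P : 'M[R]_(r, n)), [/\ (r <= n)%N, P *m G *m P^T = 1%:M &
    G *m P^T *m P *m G = G].
Proof.
move=> pG.
have ub r (P : 'M[R]_(r, n)) : P *m G *m P^T = 1%:M -> (r <= n)%N.
  move=> H; have := mxrank1 R r; rewrite -H -mulmxA => <-.
  exact: leq_trans (mxrankM_maxl _ _) (rank_leq_col _).
(* [k] bounds the number of rows that can still be added; by [ub] an orthonormal family has at most
   [n] rows. *)
suff H k r (P : 'M[R]_(r, n)) : (n - r <= k)%N -> P *m G *m P^T = 1%:M ->
    exists r' (P : 'M[R]_(r', n)), P *m G *m P^T = 1%:M /\ G *m P^T *m P *m G = G.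
  have [||r [P [P1 P2]]] := H n 0%N 0; rewrite ?subn0//.
    by apply/matrixP => -[].
  by exists r, P; split => //; exact: ub P1.
elim: k r P => [|k IH] r P nr P1;
    (have [/eqP R0|R0] := boolP (G *m P^T *m P *m G == G); first by exists r, P);
    have [v [vP vv]] := orthonormal_extend pG P1 R0.
all: have Pv : P *m G *m v^T = 0
  by apply: trmx_inj; rewrite trmx0 !trmx_mul trmxK (proj1 pG) mulmxA vP.
all: have vP1 : (col_mx v P : 'M[R]_(1 + r, n)) *m G *m (col_mx v P : 'M[R]_(1 + r, n))^T = 1%:M
  by rewrite mul_col_mx tr_col_mx mul_col_row vv vP Pv P1 -scalar_mx_block.
- by have := ub _ _ vP1; move: nr; rewrite leqn0 subn_eq0 => nr /(leq_trans) /(_ nr); rewrite ltnn.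
- by apply: IH vP1; rewrite subnS; move: nr; case: (n - r)%N.
Qed.

(** Rows are added greedily. If all of [S] lay in the row space of [M], then [S] would annihilate
    each column of [cokermx M], which would therefore vanish, and [M] would already have rank
    [p]. *)
Lemma spanning_rows p (S : set 'rV[R]_p) :
  (forall b : 'cV[R]_p, (forall v, S v -> v *m b = 0) -> b = 0) ->
  exists M : 'M[R]_p, M \in unitmx /\ forall i, S (row i M).
Proof.
move=> Sb.
suff H k : (k <= p)%N -> exists M : 'M[R]_(k, p), \rank M = k /\ forall i, S (row i M).
  have [M [rM SM]] := H p (leqnn p).
  by exists M; split => //; rewrite -row_free_unit /row_free rM.
elim: k => [|k IH] kp.
  by exists 0; split => [|[]//]; rewrite mxrank0.
have [M [rM SM]] := IH (ltnW kp).
have [v [Sv vM]] : exists v, S v /\ ~~ (v <= M)%MS.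
  apply: contrapT => /forallNP N.
  have : cokermx M = 0.
    apply/matrixP => i j; rewrite [RHS]mxE.
    have -> : (cokermx M) i j = (col j (cokermx M)) i 0 by rewrite [RHS]mxE.
    suff -> : col j (cokermx M) = 0 by rewrite [LHS]mxE.
    apply: Sb => v Sv.
    have /not_andP[//|/negP] := N v.
    by rewrite negbK submxE => /eqP vM; rewrite colE mulmxA vM mul0mx.
  by move/(congr1 mxrank)/eqP; rewrite mxrank0 mxrank_coker rM subn_eq0 leqNgt kp.
suff : exists N : 'M[R]_(1 + k, p), \rank N = (1 + k)%N /\ forall i, S (row i N) by [].
exists (col_mx v M); split; last first.
  move=> i; rewrite -[i]splitK; case: (fintype.split i) => j /=.
    by rewrite rowKu row_id.
  by rewrite rowKd.
have MS : (M <= col_mx v M)%MS by rewrite (submx_trans _ (submx_refl (col_mx v M))) // -addsmxE addsmxSr.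
apply/eqP; rewrite eqn_leq rank_leq_row -{1}rM.
have [le eqr] := mxrank_leqif_sup MS; rewrite ltn_neqAle le andbT eqr.
by apply: contra vM; rewrite col_mx_sub => /andP[].
Qed.

(** A crude bound from the Leibniz formula; it serves to make the supremum of determinants in
    [fekete_rows] finite. *)
Lemma det_bound p (M : 'M[R]_p) B : (forall i j, `|M i j| <= B) ->
  `|\det M| <= p`!%:R * B ^+ p.
Proof.
move=> MB; rewrite /determinant; apply: le_trans (ler_norm_sum _ _ _) _.
have -> : p`!%:R * B ^+ p = \sum_(s : 'S_p) B ^+ p.
  by rewrite sumr_const card_Sn mulr_natl.
apply: ler_sum => s _; rewrite normrM normrX normrN1 expr1n mul1r normr_prod.
rewrite -[in leRHS](card_ord p) -prodr_const; apply: ler_prod => i _.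
by rewrite normr_ge0 MB.
Qed.

(* Almost maximizing the determinant over rows in [S] bounds the Lagrange
   functions (Fekete points). *)
Lemma fekete_rows p (S : set 'rV[R]_p) B :
  (forall v j, S v -> `|v 0 j| <= B) ->
  (forall b : 'cV[R]_p, (forall v, S v -> v *m b = 0) -> b = 0) ->
  exists M : 'M[R]_p, [/\ M \in unitmx, forall i, S (row i M) &
    forall v i, S v -> `|(v *m invmx M) 0 i| <= 2].
Proof.
move=> SB Sspan; have [M0 [M0u SM0]] := spanning_rows Sspan.
pose A := [set `|\det M| | M in (fun M : 'M[R]_p => forall i, S (row i M))].
have A0 : A !=set0 by exists `|\det M0|, M0.
have ubA : has_ubound A.
  exists (p`!%:R * B ^+ p) => _ [M SM <-]; apply: det_bound => i j.
  by have := SB _ j (SM i); rewrite mxE.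
have sA : has_sup A by [].
have leA (M : 'M[R]_p) : (forall i, S (row i M)) -> `|\det M| <= sup A.
  by move=> SM; apply: (sup_upper_bound sA); exists M.
have supA : 0 < sup A.
  apply: lt_le_trans (leA _ SM0).
  by rewrite normr_gt0 -unitfE.
(* The supremum may not be attained. Half of it is enough, at the price of the bound 2 instead of
   1. *)
have [|_ [M SM <-] Mgt] := @sup_adherent _ A (sup A / 2) _ sA; first by rewrite divr_gt0.
have dM : 0 < `|\det M| by apply: (le_lt_trans _ Mgt); lra.
exists M; split => //; first by rewrite unitmxE unitfE -normr_gt0.
move=> v i Sv.
(* Cramer's rule: the i-th coordinate of [v *m invmx M] is the quotient of [\det N] by [\det M],
   where [N] has [v] as its row [i] and again all its rows in [S]. *)
pose N : 'M[R]_p := \matrix_(k, j) (if k == i then v 0 j else M k j).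
have Ndet : (v *m invmx M) 0 i = (\det M)^-1 * \det N.
  rewrite /invmx unitmxE unitfE -normr_gt0 dM -scalemxAr mxE; congr (_ * _).
  rewrite (expand_det_row N i) mxE; apply: eq_bigr => j _; rewrite !mxE eqxx.
  congr (_ * _); rewrite /cofactor; congr (_ * \det _).
  apply/matrixP => k l; rewrite !mxE; case: eqP => // /eqP; rewrite eq_sym.
  by rewrite (negbTE (neq_lift _ _)).
have SN k : S (row k N).
  have [->|ki] := eqVneq k i.
    suff -> : row i N = v by [].
    by apply/rowP => j; rewrite !mxE eqxx.
  suff -> : row k N = row k M by [].
  by apply/rowP => j; rewrite !mxE (negbTE ki).
rewrite Ndet normrM normfV mulrC ler_pdivrMr//.
by have := leA _ SN; lra.
Qed.

End linear_algebra.

(** * Integrals depend only on the law *)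

Section same_law.
Context d (Om : measurableType d) (R : realType) (P : probability Om R).

Lemma law_integral d' (T : measurableType d') (U : Om -> T)
    (Q : {measure set T -> \bar R}) (f : T -> \bar R) :
  measurable_fun setT U -> (forall A, measurable A -> P (U @^-1` A) = Q A) ->
  measurable_fun setT f -> (forall x, 0 <= f x)%E ->
  (\int[P]_x f (U x) = \int[Q]_x f x)%E.
Proof.
move=> mU UQ mf f0.
have := ge0_integral_pushforward mU P measurableT mf (fun x _ => f0 x).
rewrite preimage_setT => <-.
by apply: eq_measure_integral => A mA _; rewrite /pushforward; apply: UQ.
Qed.

Lemma same_law_integral d' (T : measurableType d') (U U' : Om -> T) (f : T -> \bar R) :
  measurable_fun setT U -> measurable_fun setT U' ->
  (forall A, measurable A -> P (U @^-1` A) = P (U' @^-1` A)) ->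
  measurable_fun setT f -> (forall x, 0 <= f x)%E ->
  (\int[P]_x f (U x) = \int[P]_x f (U' x))%E.
Proof.
move=> mU mU' UU' mf f0.
have := ge0_integral_pushforward mU P measurableT mf (fun x _ => f0 x).
have := ge0_integral_pushforward mU' P measurableT mf (fun x _ => f0 x).
rewrite !preimage_setT => <- <-.
by apply: eq_measure_integral => A mA _; rewrite /pushforward; apply: UU'.
Qed.

Lemma bounded_integrable (f : Om -> R) M : measurable_fun setT f -> (forall x, `|f x| <= M) ->
  P.-integrable setT (EFin \o f).
Proof.
move=> mf fM; apply: (@le_integrable _ _ _ _ _ _ _ (cst M%:E)) => //.
- exact/measurable_EFinP.
- by move=> x _ /=; rewrite lee_fin (le_trans (fM x))// ler_norm.
- exact: finite_measure_integrable_cst.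
Qed.

Lemma bounded_cvg_Rintegral (f_ : nat -> Om -> R) f M :
  (forall n, measurable_fun setT (f_ n)) -> (forall n x, `|f_ n x| <= M) ->
  (forall x, f_ ^~ x @ \oo --> f x) ->
  \int[P]_x f_ n x @[n --> \oo] --> \int[P]_x f x.
Proof.
move=> mf fM cf.
have mff : measurable_fun setT f by apply: (measurable_fun_cvg mf) => x _; exact: cf.
have fM' x : `|f x| <= M.
  rewrite -(cvg_lim _ (cvg_norm (cf x)))//; apply: limr_le; last exact: nearW.
  by apply/cvg_ex; eexists; apply: cvg_norm; exact: cf.
have fin : (\int[P]_x (f x)%:E)%E \is a fin_num.
  exact: integrable_fin_num (bounded_integrable mff fM').
apply: fine_cvg; rewrite fineK//.
have [] := @dominated_convergence _ _ _ P setT measurableT (fun n => EFin \o f_ n)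
  (EFin \o f) (cst M%:E) => //.
- by move=> n; exact/measurable_EFinP.
- exact/measurable_EFinP.
- by apply: aeW => x _; apply: cvg_EFin; [exact: nearW|exact: cf].
- exact: finite_measure_integrable_cst.
- by apply: aeW => x n _; rewrite lee_fin.
Qed.


End same_law.

(** * The sign as a limit of polynomials in sines *)

Section sign_approximation.
Context {R : realType}.

(** The Newton-Schulz iteration for the sign: an odd cubic that maps [-1, 1] into itself and whose
    fixed points are -1, 0 and 1. Being polynomial, its iterates stay inside any algebra of
    functions. *)
Definition sgstep (v : R) := (3 * v - v ^+ 3) / 2.

Lemma sgstep_bound v : `|v| <= 1 -> `|sgstep v| <= 1.
Proof.
rewrite !ler_norml /sgstep => /andP[v1 v2].
have h1 : 0 <= (1 - v) ^+ 2 * (2 + v) by rewrite mulr_ge0 ?sqr_ge0//; lra.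
have h2 : 0 <= (1 + v) ^+ 2 * (2 - v) by rewrite mulr_ge0 ?sqr_ge0//; lra.
by apply/andP; split; lra.
Qed.

Lemma sgstep_iter_bound k v : `|v| <= 1 -> `|iter k sgstep v| <= 1.
Proof. by move=> v1; elim: k => //= k; exact: sgstep_bound. Qed.

Lemma sgstep_iterN k v : iter k sgstep (- v) = - iter k sgstep v.
Proof. by elim: k => //= k ->; rewrite /sgstep; field. Qed.

Lemma sgstep_cvg_gt0 v : 0 < v <= 1 -> iter k sgstep v @[k --> \oo] --> (1 : R).
Proof.
move=> /andP[v0 v1].
(* For a positive start the iterates never fall below [v], so the distance to 1 shrinks at each step
   by the fixed factor 1 - v/2. *)
have H k : v <= iter k sgstep v <= 1 /\ 1 - iter k sgstep v <= (1 - v / 2) ^+ k.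
  elim: k => [|k [/andP[IH1 IH2] IH3]]; first by rewrite /= expr0 lexx v1; split => //; lra.
  rewrite iterS; move: IH1 IH2 IH3; set w := iter k sgstep v => vw w1 IH.
  split.
    have h1 : 0 <= w * (1 - w ^+ 2) by rewrite mulr_ge0//; nra.
    have h2 : 0 <= (1 - w) ^+ 2 * (2 + w) by rewrite mulr_ge0 ?sqr_ge0//; lra.
    by rewrite /sgstep; apply/andP; split; lra.
  rewrite exprS; apply: le_trans (_ : (1 - v / 2) * (1 - w) <= _).
    rewrite /sgstep -subr_ge0.
    rewrite (_ : _ - _ = (1 - w) / 2 * ((w - v) + w ^+ 2)); last by field.
    by rewrite mulr_ge0//; [lra|nra].
  by rewrite ler_wpM2l//; lra.
apply/cvgrPdist_le => e e0.
have : (1 - v / 2) ^+ k @[k --> \oo] --> 0.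
  by apply: cvg_expr; rewrite ger0_norm; lra.
move=> /cvgrPdist_le /(_ e e0); apply: filterS => k.
have [/andP[_ k1] k2] := H k.
rewrite sub0r normrN ger0_norm; last by rewrite exprn_ge0//; lra.
by move=> k3; rewrite ger0_norm; lra.
Qed.

Lemma sgstep_cvg v : `|v| <= 1 -> iter k sgstep v @[k --> \oo] --> Num.sg v.
Proof.
rewrite ler_norml => /andP[v1 v2].
have [v0|v0|v0] := ltgtP v 0.
- rewrite ltr0_sg// -[v]opprK.
  under eq_cvg do rewrite sgstep_iterN.
  by apply: cvgN; apply: sgstep_cvg_gt0; rewrite oppr_gt0 v0/=; lra.
- by rewrite gtr0_sg//; apply: sgstep_cvg_gt0; rewrite v0.
- rewrite v0 sgr0; suff E k : iter k sgstep (0 : R) = 0.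
    by under eq_cvg do rewrite E; exact: cvg_cst.
  by elim: k => //= k ->; rewrite /sgstep; field.
Qed.

(** As soon as [k] exceeds |x| / pi, the angle [x / k.+1%:R] lies in (-pi, pi), where the sine has
    the sign of its argument. This replaces an unbounded coordinate by bounded functions. *)
Lemma sg_sin_cvg (x : R) : Num.sg (sin (x / k.+1%:R)) @[k --> \oo] --> Num.sg x.
Proof.
have pos y : 0 < y -> \forall k \near \oo, Num.sg (sin (y / k.+1%:R)) = 1.
  move=> y0; near=> k.
  rewrite gtr0_sg// sin_gt0_pi// divr_gt0//=.
  rewrite ltr_pdivrMr//.
  apply: (@lt_le_trans _ _ (pi * k%:R)).
    rewrite mulrC -ltr_pdivrMr ?pi_gt0//.
    near: k; apply: nbhs_infty_gtr.
  by rewrite ler_pM2l ?pi_gt0// ler_nat.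
have [x0|x0|x0] := ltgtP x 0.
- rewrite ltr0_sg//; apply: cvg_near_cst.
  have : 0 < - x by rewrite oppr_gt0.
  move=> /pos; apply: filterS => k /eqP.
  by rewrite mulNr sinN sgrN eqr_oppLR => /eqP.
- by rewrite gtr0_sg//; apply: cvg_near_cst; exact: pos.
- by rewrite x0 sgr0; under eq_cvg do rewrite mul0r sin0 sgr0; exact: cvg_cst.
Unshelve. all: by end_near. Qed.

End sign_approximation.

(** * The Cramer-Wold device *)

Section cramer_wold.
Context d (Om : measurableType d) (R : realType) (P : probability Om R).
Context n (U U' : Om -> n.-tuple R).
Hypothesis mU : measurable_fun setT U.
Hypothesis mU' : measurable_fun setT U'.

Let lin (a : 'I_n -> R) (t : n.-tuple R) : R := \sum_i a i * tnth t i.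

Let mlin a : measurable_fun setT (lin a).
Proof.
apply: measurable_sum => i; apply: measurable_funM => //.
exact: measurable_tnth.
Qed.

Hypothesis UU' : forall a (A : set R), measurable A ->
  P [set w | A (lin a (U w))] = P [set w | A (lin a (U' w))].

Let bm (F : n.-tuple R -> R) := measurable_fun setT F /\ exists M, forall x, `|F x| <= M.

Let bmM F G : bm F -> bm G -> bm (fun x => F x * G x).
Proof.
move=> [mF [M FM]] [mG [M' GM]]; split; first exact: measurable_funM.
exists (M * M') => x; rewrite normrM; exact: ler_pM.
Qed.

Let bmD F G : bm F -> bm G -> bm (fun x => F x + G x).
Proof.
move=> [mF [M FM]] [mG [M' GM]]; split; first exact: measurable_funD.
by exists (M + M') => x; apply: le_trans (ler_normD _ _) _; exact: lerD.
Qed.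

Let bm_cst c : bm (fun _ => c).
Proof. by split; [exact: measurable_cst|exists `|c|]. Qed.

Let bm_cos a s : bm (fun x => cos (lin a x + s)).
Proof.
split; last by exists 1 => x; rewrite ler_norml cos_geN1 cos_le1.
apply: (measurableT_comp (f := cos)); last exact: measurable_funD.
apply: continuous_measurable_fun; exact: continuous_cos.
Qed.

Let same F := \int[P]_w F (U w) = \int[P]_w F (U' w).

Let bm_int F : bm F -> P.-integrable setT (EFin \o (fun w => F (U w))) /\
  P.-integrable setT (EFin \o (fun w => F (U' w))).
Proof.
move=> [mF [M FM]]; split; apply: (@bounded_integrable _ _ _ _ _ M) => //.
- exact: measurableT_comp.
- exact: measurableT_comp.
Qed.

Let sameD F G : bm F -> bm G -> same F -> same G -> same (fun x => F x + G x).
Proof.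
move=> /bm_int[i1 i2] /bm_int[j1 j2] FF GG.
by rewrite /same RintegralD// [RHS]RintegralD// FF GG.
Qed.

Let sameZ c F : bm F -> same F -> same (fun x => c * F x).
Proof.
by move=> /bm_int[i1 i2] FF; rewrite /same RintegralZl// [RHS]RintegralZl// FF.
Qed.

(* Functions with the same Fourier transform against both laws; multiplying by
   [u] below preserves this class for every [u] in an algebra containing the
   cosines and closed under bounded limits, hence for all indicators. *)
Let good F := bm F /\ forall a s, same (fun x => F x * cos (lin a x + s)).

Let multiplier u := bm u /\ forall F, good F -> good (fun x => F x * u x).

Let eq_multiplier u v : u =1 v -> multiplier u -> multiplier v.
Proof. by move=> /funext ->. Qed.

Let eq_same u v : u =1 v -> same u -> same v.
Proof. by move=> /funext ->. Qed.

Let multiplierM u v : multiplier u -> multiplier v -> multiplier (fun x => u x * v x).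
Proof.
move=> [bu mu] [bv mv]; split; first exact: bmM.
move=> F /mu/mv.
by rewrite (_ : (fun x => F x * (u x * v x)) = (fun x => F x * u x * v x))//;
  apply/funext => x; rewrite mulrA.
Qed.

Let multiplierD u v : multiplier u -> multiplier v -> multiplier (fun x => u x + v x).
Proof.
move=> [bu mu] [bv mv]; split; first exact: bmD.
move=> F gF; split; first by apply: bmM; [case: gF|exact: bmD].
move=> a s; apply: (@eq_same (fun x => F x * u x * cos (lin a x + s) +
  F x * v x * cos (lin a x + s))); first by move=> x; rewrite mulrDr mulrDl.
apply: sameD; [..|exact: (mu _ gF).2|exact: (mv _ gF).2].
- by do 2 apply: bmM => //; case: gF.
- by do 2 apply: bmM => //; case: gF.
Qed.

Let multiplier_cst c : multiplier (fun _ => c).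
Proof.
split => // F gF; split; first by apply: bmM => //; case: gF.
move=> a s; apply: (@eq_same (fun x => c * (F x * cos (lin a x + s)))).
  by move=> x; rewrite mulrAC [RHS]mulrC.
by apply: sameZ; [apply: bmM => //; case: gF|exact: gF.2].
Qed.

(** The product-to-sum formula turns a product of two cosines into cosines of the forms a + b and a
    - b with shifts s + t and s - t; hence the arbitrary shift in [good]. *)
Let multiplier_cos a s : multiplier (fun x => cos (lin a x + s)).
Proof.
split => // F gF; split; first by apply: bmM => //; case: gF.
move=> b t.
have bF : bm F by case: gF.
apply: (@eq_same (fun x => 2^-1 * (F x * cos (lin (fun i => a i + b i) x + (s + t)) +
  F x * cos (lin (fun i => a i - b i) x + (s - t))))).
  move=> x.
  have -> : lin (fun i => a i + b i) x + (s + t) = (lin a x + s) + (lin b x + t).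
    rewrite /lin; under eq_bigr do rewrite mulrDl.
    by rewrite big_split/=; ring.
  have -> : lin (fun i => a i - b i) x + (s - t) = (lin a x + s) - (lin b x + t).
    rewrite /lin; under eq_bigr do rewrite mulrBl.
    by rewrite sumrB; ring.
  by rewrite cosD cosB; field.
by apply: sameZ; [apply: bmD; exact: bmM|apply: sameD; [exact: bmM..|exact: gF.2|exact: gF.2]].
Qed.

Let multiplier_lim M (u : nat -> n.-tuple R -> R) v :
  (forall k, multiplier (u k)) -> (forall k x, `|u k x| <= M) ->
  (forall x, u ^~ x @ \oo --> v x) -> multiplier v.
Proof.
move=> mu uM cu.
have bv : bm v.
  split; first by apply: (@measurable_fun_cvg _ _ _ _ u) => // k; case: (mu k) => -[].
  exists M => x; rewrite -(cvg_lim _ (cvg_norm (cu x)))//; apply: limr_le; last exact: nearW.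
  by apply/cvg_ex; eexists; apply: cvg_norm; exact: cu.
split => // F gF; have bF : bm F by case: gF.
split; first exact: bmM.
move=> a s.
have [_ [N FN]] := bmM bF (bm_cos a s).
have cv V : measurable_fun setT V ->
    \int[P]_w (F (V w) * u k (V w) * cos (lin a (V w) + s)) @[k --> \oo] -->
    \int[P]_w (F (V w) * v (V w) * cos (lin a (V w) + s)).
  move=> mV; apply: (@bounded_cvg_Rintegral _ _ _ _ _ _ (N * M)) => [k|k x|x].
  - apply: (measurableT_comp (f := fun x => F x * u k x * cos (lin a x + s))) => //.
    by have [] : bm (fun x => F x * u k x * cos (lin a x + s))
      by do 2 apply: bmM => //; case: (mu k).
  - rewrite mulrAC normrM; apply: ler_pM => //; exact: FN.
  - by apply: cvgM; [apply: cvgM; [exact: cvg_cst|exact: cu]|exact: cvg_cst].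
have e : (fun k => \int[P]_w (F (U w) * u k (U w) * cos (lin a (U w) + s))) =
         (fun k => \int[P]_w (F (U' w) * u k (U' w) * cos (lin a (U' w) + s))).
  apply/funext => k; have [_ /(_ _ gF) [_ FF]] := mu k; exact: FF.
have := cv _ mU; rewrite e => cvU.
exact: cvg_unique cvU (cv _ mU').
Qed.

(** The hypothesis on the laws of linear combinations enters here. *)
Let good1 : good (fun _ => 1).
Proof.
split; first exact: bm_cst.
(* Adding 1 makes the integrand nonnegative, as [same_law_integral] requires. *)
move=> a s; apply: (@eq_same (fun x => (1 + cos (lin a x + s)) + (-1))).
  by move=> x; ring.
have b1 : bm (fun x => 1 + cos (lin a x + s)) by exact: bmD.
apply: (sameD b1 (bm_cst _)) => //.
have mc : measurable_fun setT (fun y : R => (1 + cos (y + s))%:E).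
  apply/measurable_EFinP; apply: measurable_funD => //.
  apply: (measurableT_comp (f := cos)); last exact: measurable_funD.
  by apply: continuous_measurable_fun; exact: continuous_cos.
rewrite /same /Rintegral; congr fine.
apply: (@same_law_integral _ _ _ P _ _ (fun w => lin a (U w)) (fun w => lin a (U' w))
  (fun y => (1 + cos (y + s))%:E)); [| |exact: UU'|exact: mc|].
- exact: measurableT_comp.
- exact: measurableT_comp.
- by move=> x; rewrite lee_fin; have := cos_geN1 (x + s); lra.
Qed.

Let multiplier_step k u : (forall x, `|u x| <= 1) -> multiplier u ->
  multiplier (fun x => iter k sgstep (u x)).
Proof.
move=> u1 mu; elim: k => //= k IH; move: IH; set w := fun x => iter k sgstep (u x) => mw.
apply: (@eq_multiplier (fun x => 3 / 2 * w x + (- 2^-1) * (w x * (w x * w x)))).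
  by move=> x; rewrite /sgstep/= -/(w x); field.
by apply: multiplierD; apply: multiplierM => //; do 2 apply: multiplierM => //.
Qed.

(** A double limit: iterates of [sgstep] give the sign of a sine, and stretching the sine gives the
    sign of the coordinate. The sine is a cosine with shift -pi/2. *)
Let multiplier_sg i y : multiplier (fun x => Num.sg (tnth x i - y)).
Proof.
apply: (@multiplier_lim 1 (fun k x => Num.sg (sin ((tnth x i - y) / k.+1%:R)))).
- move=> k; apply: (@multiplier_lim 1 (fun l x => iter l sgstep (sin ((tnth x i - y) / k.+1%:R)))).
  + move=> l; apply: multiplier_step.
      by move=> x; rewrite ler_norml sin_geN1 sin_le1.
    apply: eq_multiplier (multiplier_cos (fun j => (j == i)%:R / k.+1%:R) (- y / k.+1%:R - pi / 2)) => x.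
    rewrite addrA cosBpihalf /lin (bigD1 i)//= eqxx big1 => [|j /negbTE ->].
      by rewrite addr0 [true%:R]/(1 : R) mul1r mulrC -mulrDl.
    by rewrite !mul0r.
  + by move=> l x; apply: sgstep_iter_bound; rewrite ler_norml sin_geN1 sin_le1.
  + by move=> x; apply: sgstep_cvg; rewrite ler_norml sin_geN1 sin_le1.
- by move=> k x; rewrite normr_sg; case: (_ != _).
- by move=> x; exact: sg_sin_cvg.
Qed.

(** Multipliers are closed under products, so the sets are closed under finite intersections, and
    bounded limits give the countable ones: a sigma-algebra results at once, without a monotone
    class argument. *)
Let multiplier_sigma_algebra : sigma_algebra setT [set A : set (n.-tuple R) | multiplier \1_A].
Proof.
have C A : multiplier \1_A -> multiplier \1_(~` A).
  move=> mA; apply: (@eq_multiplier (fun x => 1 + (-1) * \1_A x)).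
    by move=> x; rewrite !indicE in_setC; case: (x \in A); rewrite /= ?mulr1 ?mulr0 ?subrr ?addr0.
  by apply: multiplierD => //; exact: multiplierM.
have I A B : multiplier \1_A -> multiplier \1_B -> multiplier \1_(A `&` B).
  move=> mA mB; apply: eq_multiplier (multiplierM mA mB) => x.
  by rewrite !indicE in_setI -natrM mulnb.
split => /=.
- by apply: eq_multiplier (multiplier_cst 0) => x; rewrite indic0.
- by move=> A mA; rewrite setTD; exact: C.
- move=> A mA; rewrite -[X in \1_X]setCK setC_bigcup; apply: (C).
  pose B k := \big[setI/setT]_(i < k) ~` A i.
  apply: (@multiplier_lim 1 (fun k => \1_(B k))).
  + move=> k; rewrite /B; elim: k => [|k IH].
      by rewrite big_ord0; apply: eq_multiplier (multiplier_cst 1) => x; rewrite indicT.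
    by rewrite big_ord_recr/=; apply: I => //; exact: C.
  + by move=> k x; rewrite indicE ger0_norm ?ler0n// lern1 leq_b1.
  + move=> x; apply: cvg_near_cst.
    have [xA|/existsNP [k]] := pselect (forall i, (~` A i) x).
      near=> k; rewrite !indicE !mem_set//.
      by rewrite /B -(bigcap_mkord _ (fun i => ~` A i)) => i _; exact: xA.
    rewrite /setC/= => /contrapT Akx.
    near=> l; rewrite !indicE !memNset//.
      by move=> /(_ k Logic.I).
    rewrite /B -(bigcap_mkord _ (fun i => ~` A i)) => /(_ k); apply => //=.
    by near: l; exact: nbhs_infty_gt.
Unshelve. all: by end_near. Qed.

Let multiplier_measurable (A : set (n.-tuple R)) : measurable A -> multiplier \1_A.
Proof.
suff : (measurable : set (set (n.-tuple R))) `<=` [set A | multiplier \1_A] by exact.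
apply: smallest_sub; first exact: multiplier_sigma_algebra.
apply: (@big_ind _ (fun S => S `<=` [set A | multiplier \1_A])) => //.
  by move=> S S' SA S'A B [/SA|/S'A].
move=> j _ _ [C mC <-]; rewrite /= setTI; move: C mC.
have [S0 SC Sb] := multiplier_sigma_algebra.
suff : (@ocitv R).-sigma.-measurable `<=` [set C | multiplier \1_((tnth (T := R))^~ j @^-1` C)] by exact.
rewrite RGenInftyO.measurableE; apply: smallest_sub.
  split => /=.
  - by rewrite preimage_set0.
  - by move=> B mB; rewrite setTD preimage_setC -setTD; exact: SC.
  - by move=> F mF; rewrite preimage_bigcup; exact: Sb.
move=> _ [y ->] /=.
(* The indicator of a negative number with sign s is (s^2 - s) / 2. *)
apply: (@eq_multiplier (fun x => 2^-1 * (Num.sg (tnth x j - y) * Num.sg (tnth x j - y)) +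
  (- 2^-1) * Num.sg (tnth x j - y))).
  move=> x; rewrite indicE.
  have -> : (x \in (tnth (T := R))^~ j @^-1` `]-oo, y[) = (tnth x j < y).
    by apply/idP/idP; rewrite inE/= in_itv.
  have [h|h|h] := ltgtP (tnth x j) y.
  - by rewrite ltr0_sg ?subr_lt0//=; field.
  - by rewrite gtr0_sg ?subr_gt0//=; ring.
  - by rewrite h subrr sgr0/=; ring.
by apply: multiplierD; repeat apply: multiplierM.
Qed.

Theorem cramer_wold (A : set (n.-tuple R)) : measurable A ->
  P (U @^-1` A) = P (U' @^-1` A).
Proof.
(* With the constant function 1 and the zero frequency the cosine is 1, and only the integral of the
   indicator remains. *)
move=> mA; have [_ /(_ _ good1) [_ /(_ (fun=> 0) 0)]] := multiplier_measurable mA.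
have E V : measurable_fun setT V ->
    \int[P]_w (1 * \1_A (V w) * cos (lin (fun=> 0) (V w) + 0)) = fine (P (V @^-1` A)).
  move=> mV; rewrite /Rintegral; congr fine.
  rewrite -[V @^-1` A]setIT -integral_indic//; last by rewrite -[X in measurable X]setTI; exact: mV.
  apply: eq_integral => w _; rewrite /lin big1 ?addr0 ?cos0 ?mulr1 ?mul1r//.
  by move=> i _; rewrite mul0r.
rewrite /same (E _ mU) (E _ mU') => e.
have mp (V : Om -> n.-tuple R) : measurable_fun setT V -> measurable (V @^-1` A).
  by move=> mV; rewrite -[V @^-1` A]setTI; exact: (mV measurableT _ mA).
have /fineK <- := fin_num_measure P _ (mp _ mU).
have /fineK <- := fin_num_measure P _ (mp _ mU').
by rewrite e.
Qed.

End cramer_wold.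

(** * Integration against a measure given by a density *)

Section density.
Context d (T : measurableType d) (R : realType).
Variables mu nu : {measure set T -> \bar R}.
Variable g : T -> R.
Hypothesis mg : measurable_fun setT g.
Hypothesis g0 : forall x, 0 <= g x.
Hypothesis nuE : forall A, measurable A -> nu A = (\int[mu]_(x in A) (g x)%:E)%E.
Local Open Scope ereal_scope.
Import HBNNSimple.

Let meg : measurable_fun setT (EFin \o g).
Proof. exact/measurable_EFinP. Qed.

Let integral_density_nnsfun (h : {nnsfun T >-> R}) :
  \int[nu]_x (h x)%:E = \int[mu]_x ((h x)%:E * (g x)%:E).
Proof.
have mh r : measurable (h @^-1` [set r]) by [].
have mi r : measurable_fun setT (fun x => (r * \1_(h @^-1` [set r]) x)%:E).
  by apply/measurable_EFinP; exact: measurable_funM.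
have hE x : (h x)%:E = \sum_(r \in range h) (r * \1_(h @^-1` [set r]) x)%:E.
  by rewrite fsumEFin// -fimfunE.
transitivity (\sum_(r \in range h) \int[nu]_x (r * \1_(h @^-1` [set r]) x)%:E).
  under eq_integral do rewrite hE.
  by rewrite ge0_integral_fsum// => r x _; exact: nnfun_muleindic_ge0.
transitivity (\sum_(r \in range h) \int[mu]_x ((r * \1_(h @^-1` [set r]) x)%:E * (g x)%:E)); last first.
  rewrite -ge0_integral_fsum//.
  - apply: eq_integral => x _; rewrite hE ge0_mule_fsuml// => r.
    exact: nnfun_muleindic_ge0.
  - by move=> r; exact: (emeasurable_funM (mi r) meg).
  - by move=> r x _; rewrite mule_ge0 ?nnfun_muleindic_ge0 ?lee_fin.
apply: eq_fsbigr => r /[!inE] -[t _ <-]; set r' := h t.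
have r0 : (0 <= r')%R by exact: fun_ge0.
have ei x : (0 <= (\1_(h @^-1` [set r']) x)%:E :> \bar R) by rewrite lee_fin.
have mi1 : measurable_fun setT (fun x => (\1_(h @^-1` [set r']) x)%:E : \bar R).
  by apply/measurable_EFinP; exact: measurable_indic.
under eq_integral do rewrite EFinM.
under [RHS]eq_integral do rewrite EFinM -muleA.
rewrite ge0_integralZl// [RHS]ge0_integralZl//; last 2 first.
- exact: (emeasurable_funM mi1 meg).
- by move=> x _; rewrite mule_ge0 ?lee_fin.
congr (_ * _); rewrite integral_indic// setIT nuE// [LHS]integral_mkcond.
apply: eq_integral => x _; rewrite /patch indicE.
by case: ifPn => _; rewrite ?mul1e ?mul0e.
Qed.

Lemma integral_density (f : T -> \bar R) :
  measurable_fun setT f -> (forall x, 0 <= f x) ->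
  \int[nu]_x f x = \int[mu]_x (f x * (g x)%:E).
Proof.
move=> mf f0; pose h := nnsfun_approx measurableT mf.
have ch x : (h n x)%:E @[n --> \oo] --> f x by exact: cvg_nnsfun_approx.
have nh x : {homo (fun n => (h n x)%:E) : m n / (m <= n)%N >-> m <= n}.
  by move=> m n mn; rewrite lee_fin; exact/lefP/nd_nnsfun_approx.
have h0 n x : 0 <= (h n x)%:E by rewrite lee_fin.
have mh n : measurable_fun setT (EFin \o h n) by exact/measurable_EFinP.
have := @cvg_monotone_convergence _ _ _ nu _ measurableT (fun n => EFin \o h n) mh
  (fun n x _ => h0 n x) (fun x _ => nh x).
have <- : \int[nu]_x f x = \int[nu]_x limn (EFin \o h ^~ x).
  by apply: eq_integral => x _; apply/esym/cvg_lim => //; exact: ch.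
have -> : (fun n => \int[nu]_x (EFin \o h n) x) = fun n => \int[mu]_x ((h n x)%:E * (g x)%:E).
  by apply/funext => n; exact: integral_density_nnsfun.
move/cvg_lim => <- //; apply/cvg_lim => //.
have -> : \int[mu]_x (f x * (g x)%:E) = \int[mu]_x limn (fun n => (h n x)%:E * (g x)%:E).
  by apply: eq_integral => x _; apply/esym/cvg_lim => //; apply: cvgeZr => //; exact: ch.
apply: cvg_monotone_convergence => //.
- by move=> n; exact: (emeasurable_funM (mh n) meg).
- by move=> n x _; rewrite mule_ge0 ?lee_fin.
- by move=> x _ m n mn; rewrite lee_wpmul2r ?lee_fin//; exact: nh.
Qed.

End density.

(** * Second moments of centred Gaussian laws *)

Section gaussian_second_moment.
Context {R : realType}.
Notation mu := (@lebesgue_measure R).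
Implicit Types s : R.

Lemma normal_second_moment s : 0 < s ->
  (\int[mu]_x (x ^+ 2 * normal_pdf 0 s x)%:E = (s ^+ 2)%:E * \int[mu]_x (x ^+ 2 * normal_pdf 0 1 x)%:E)%E.
Proof.
move=> s0.
pose F := fun x : R => x / s.
have D' : F^`()%classic = cst s^-1.
  apply/funext => x; rewrite derive1E deriveM//.
  by rewrite derive_id derive_cst scaler0 add0r scaler1.
have s10 : s^-1 > 0 by rewrite invr_gt0.
pose G := fun x : R => x ^+ 2 * normal_pdf 0 1 x.
have -> : (\int[mu]_x (G x)%:E = \int[mu]_x (((G \o F) * F^`()%classic) x)%:E)%E.
  apply: increasing_ge0_integration_by_substitutionT => //.
  - by rewrite /F => a b ab; rewrite ltr_pM2r.
  - by rewrite D' => ?; exact: cvg_cst.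
  - by rewrite D'; exact: is_cvg_cst.
  - by rewrite D'; exact: is_cvg_cst.
  - by apply: gt0_cvgMlNy => //; exact: cvg_id.
  - by apply: gt0_cvgMly => //; exact: cvg_id.
  - move=> x; apply: cvgM; first exact: exprn_continuous.
    by apply: continuous_normal_pdf; rewrite oner_eq0.
  - by rewrite /G => a; rewrite mulr_ge0 ?sqr_ge0 ?normal_pdf_ge0.
have -> : ((s ^+ 2)%:E * \int[mu]_x (((G \o F) * F^`()%classic) x)%:E =
    \int[mu]_x ((s ^+ 2)%:E * (((G \o F) * F^`()%classic) x)%:E))%E.
  rewrite ge0_integralZl//.
  - apply/measurable_EFinP; rewrite D'; apply: measurable_funM => //.
    apply: (measurableT_comp (f := G)) => //.
      by apply: measurable_funM; [exact: measurable_funX|exact: measurable_normal_pdf].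
    by apply: measurable_funM.
  - move=> x _; rewrite lee_fin D' !fctE; apply: mulr_ge0; last exact: ltW.
    by apply: mulr_ge0; [exact: sqr_ge0|exact: normal_pdf_ge0].
  - by rewrite lee_fin sqr_ge0.
apply: eq_integral => x _; rewrite D' -EFinM /G /F !fctE /=; congr EFin.
rewrite !normal_pdfE ?oner_eq0 ?gt_eqF//.
have -> : normal_fun 0 1 (x / s) = normal_fun 0 s x.
  by rewrite /normal_fun; congr expR; rewrite !subr0; field; rewrite gt_eqF.
have -> : normal_peak s = normal_peak 1 / s.
  rewrite /normal_peak expr1n mul1r -mulrnAr sqrtrM ?sqr_ge0// sqrtr_sqr gtr0_norm//.
  by rewrite invfM mulrC.
by field; rewrite gt_eqF.
Qed.

(** Positivity and finiteness suffice for this moment to be cancelled in [gauss1_inj], so its value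
    is left unevaluated. *)
Lemma normal_second_moment_fin :
  (0 < \int[mu]_x (x ^+ 2 * normal_pdf 0 1 x)%:E < +oo)%E.
Proof.
(* The density of variance 2 dominates: x^2 exp(- x^2/2) is at most 4 exp(- x^2/4), because x^2/4 is
   at most exp(x^2/4). *)
pose r : R := Num.sqrt 2.
have r0 : r != 0 by rewrite gt_eqF// sqrtr_gt0.
have mI : measurable_fun setT (fun x : R => x ^+ 2 * normal_pdf 0 1 x).
  by apply: measurable_funM; [exact: measurable_funX|exact: measurable_normal_pdf].
have I0 (x : R) : (0 <= (x ^+ 2 * normal_pdf 0 1 x)%:E)%E.
  by rewrite lee_fin mulr_ge0 ?sqr_ge0 ?normal_pdf_ge0.
apply/andP; split; last first.
  pose c := 4 * normal_peak 1 / normal_peak r.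
  apply: (@le_lt_trans _ _ (\int[mu]_x (c%:E * (normal_pdf 0 r x)%:E))%E).
    apply: ge0_le_integral => //.
    - exact/measurable_EFinP.
    - by apply: emeasurable_funM => //; apply/measurable_EFinP; exact: measurable_normal_pdf.
    move=> x _; rewrite -EFinM lee_fin !normal_pdfE ?oner_eq0// /c.
    rewrite (_ : _ * (_ * _) = normal_peak 1 * (x ^+ 2 * normal_fun 0 1 x)); last by ring.
    rewrite [leRHS](_ : _ = normal_peak 1 * (4 * normal_fun 0 r x)); last first.
      by field; rewrite gt_eqF// normal_peak_gt0.
    rewrite ler_wpM2l ?normal_peak_ge0// /normal_fun !subr0 sqr_sqrtr//.
    rewrite (_ : - x ^+ 2 / (1 ^+ 2 *+ 2) = - (x ^+ 2 / 4) + - x ^+ 2 / (2 *+ 2)); last by field.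
    rewrite expRD mulrA ler_wpM2r ?expR_ge0// expRN ler_pdivrMr ?expR_gt0//.
    by have := expR_ge1Dx (x ^+ 2 / 4); lra.
  rewrite ge0_integralZl//.
  - by rewrite integral_normal_pdf mule1 ltry.
  - by apply/measurable_EFinP; exact: measurable_normal_pdf.
  - by move=> x _; rewrite lee_fin normal_pdf_ge0.
  - by rewrite lee_fin !mulr_ge0 ?invr_ge0 ?normal_peak_ge0.
rewrite lt_neqAle integral_ge0//= andbT; apply/eqP => E.
have : (\int[mu]_x `|(x ^+ 2 * normal_pdf 0 1 x)%:E| = 0)%E.
  by rewrite E; apply: eq_integral => x _; rewrite gee0_abs.
have meI : measurable_fun setT (fun x : R => (x ^+ 2 * normal_pdf 0 1 x)%:E).
  exact/measurable_EFinP.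
move/ae_eq_integral_abs => /(_ measurableT meI) [N [mN N0 sN]].
(* The integrand is positive on [1, 2], so a zero integral would make this interval a null set. *)
have : (mu `[1%R, 2%R] <= mu N)%E.
  apply: le_measure => //; rewrite ?inE// => x /= /[!in_itv]/= /andP[x1 x2].
  apply: sN => /= /(_ Logic.I) /eqP; rewrite eqe gt_eqF// mulr_gt0//.
    by rewrite exprn_gt0//; lra.
  by rewrite normal_pdfE ?oner_eq0// mulr_gt0 ?normal_peak_gt0 ?oner_eq0 ?expR_gt0.
by rewrite N0 lebesgue_measure_itv/= lte_fin ltr1n -EFinD lee_fin; lra.
Qed.

Context d (Om : measurableType d) (P : probability Om R).

Lemma gauss1_second_moment (L : Om -> R) s : 0 <= s -> measurable_fun setT L ->
  (forall A : set R, measurable A -> P (L @^-1` A) = gauss1 s A) ->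
  (\int[P]_w (L w ^+ 2)%:E = (s ^+ 2)%:E * \int[mu]_x (x ^+ 2 * normal_pdf 0 1 x)%:E)%E.
Proof.
move=> s0 mL PL.
have m2 : measurable_fun setT (fun x : R => (x ^+ 2)%:E).
  by apply/measurable_EFinP; exact: measurable_funX.
have p2 (x : R) : (0 <= (x ^+ 2)%:E)%E by rewrite lee_fin sqr_ge0.
have [s1|s1|s00] := ltgtP 0 s.
- rewrite (@law_integral _ _ _ _ _ (measurableTypeR R) L (normal_prob 0 s) _ mL _ m2 p2); last first.
    by move=> A mA; rewrite [LHS]PL// /gauss1 gt_eqF.
  rewrite (@integral_density _ _ _ mu _ (normal_pdf 0 s))//.
  + by under eq_integral do rewrite -EFinM; exact: normal_second_moment.
  + exact: measurable_normal_pdf.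
  + by move=> x; exact: normal_pdf_ge0.
- by move: s1; rewrite ltNge s0.
- rewrite (@law_integral _ _ _ _ _ (measurableTypeR R) L (@dirac _ (measurableTypeR R) (0 : R) R) _ mL _ m2 p2); last first.
    by move=> A mA; rewrite [LHS]PL// /gauss1 -s00 eqxx.
  by rewrite integral_dirac// diracT mul1e -s00 !expr0n/= mul0e.
Qed.

Lemma gauss1_sqint (L : Om -> R) s : 0 <= s -> measurable_fun setT L ->
  (forall A : set R, measurable A -> P (L @^-1` A) = gauss1 s A) -> sqint P L.
Proof.
move=> s0 mL PL; split => //; rewrite (gauss1_second_moment s0 mL PL).
have /andP[_ ?] := normal_second_moment_fin.
by rewrite lte_mul_pinfty ?lee_fin ?sqr_ge0.
Qed.

(** Both second moments are the same positive finite multiple of the squared parameter, so they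
    determine the nonnegative [s] and with it the law, including the degenerate one. *)
Lemma gauss1_inj (L L' : Om -> R) s s' : 0 <= s -> 0 <= s' ->
  measurable_fun setT L -> measurable_fun setT L' ->
  (forall A : set R, measurable A -> P (L @^-1` A) = gauss1 s A) ->
  (forall A : set R, measurable A -> P (L' @^-1` A) = gauss1 s' A) ->
  (\int[P]_w (L w ^+ 2)%:E = \int[P]_w (L' w ^+ 2)%:E)%E ->
  forall A : set R, measurable A -> P (L @^-1` A) = P (L' @^-1` A).
Proof.
move=> s0 s'0 mL mL' PL PL'.
rewrite (gauss1_second_moment s0 mL PL) (gauss1_second_moment s'0 mL' PL').
have /andP[I0 Iy] := normal_second_moment_fin.
have If : (\int[mu]_x (x ^+ 2 * normal_pdf 0 1 x)%:E \is a fin_num)%E by rewrite ge0_fin_numE// ltW.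
rewrite -(fineK If) -!EFinM => -[] /mulIf.
rewrite gt_eqF ?fine_gt0 ?I0// => /(_ isT) /eqP.
by rewrite eqrXn2// => /eqP ss' A mA; rewrite PL// PL'// ss'.
Qed.

End gaussian_second_moment.

(** * Borel sets of a separable normed space *)

Section borel_normed.
Context {R : realType} (V : normedModType R).

Lemma measurable_open_borel (A : set V) : open A -> measurable (A : set (borel V)).
Proof. by move=> oA; exact: sub_sigma_algebra. Qed.

Lemma continuous_measurable_borel (L : V -> R) : continuous L ->
  measurable_fun setT (L : borel V -> R).
Proof.
move=> cL; apply: (measurability _ (RGenOpens.measurableE R)) => //.
move=> _ [_ [a [b ->]] <-]; rewrite setTI; apply: measurable_open_borel.
by move/continuousP : cL; apply; exact: interval_open.
Qed.

Lemma countable_dense_seq (S : set V) : countable S -> closure S = setT ->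
  exists s : nat -> V, forall f e, 0 < e -> exists i, ball (s i) e f.
Proof.
move=> /countable_injP[idx idxP] Sd.
pose s i := xget 0 [set v | S v /\ idx v = i].
exists s => f e e0.
have : closure S f by rewrite Sd.
move=> /(_ _ (nbhsx_ballx f e e0)) [v [Sv fv]].
exists (idx v); suff -> : s (idx v) = v by exact: ball_sym.
rewrite /s; case: xgetP => [w _ [Sw wv]|/(_ v)]; last by case.
by apply: idxP; rewrite ?inE.
Qed.

Context d (X : measurableType d).

(** The argument [f] is replaced by the first member of a dense sequence within distance 1/(n + 1).
    The index of that member has Borel level sets, so the approximant is measurable on the product,
    and continuity in [f] gives the pointwise limit. *)
Lemma measurable_caratheodory (S : set V) (h : V -> X -> R) :
  countable S -> closure S = setT ->
  (forall x, continuous (fun f => h f x)) -> (forall f, measurable_fun setT (h f)) ->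
  measurable_fun setT (fun p : borel V * X => h p.1 p.2).
Proof.
move=> Sc Sd ch mh; have [s sd] := countable_dense_seq Sc Sd.
have ex n f : exists i, `[< ball (s i) n.+1%:R^-1 f >].
  by have [|i si] := sd f n.+1%:R^-1; [rewrite invr_gt0|exists i; apply/asboolP].
pose k n f := ex_minn (ex n f).
have mk n i : measurable ([set f | k n f = i] : set (borel V)).
  have -> : [set f | k n f = i] = ball (s i) n.+1%:R^-1 `&`
      \bigcap_(j in [set j | (j < i)%N]) ~` ball (s j) n.+1%:R^-1.
    apply/seteqP; split => [f /= <-|f /= [fi fj]]; rewrite /k.
      case: ex_minnP => l /asboolP fl lmin; split => // j /= jl fj.
      by have := lmin j; rewrite leqNgt jl => /(_ (asboolT fj)).
    case: ex_minnP => l /asboolP fl lmin; apply/eqP; rewrite eqn_leq lmin ?asboolT//=.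
    by rewrite leqNgt; apply/negP => /fj /(_ fl).
  apply: measurableI; first by apply: measurable_open_borel; apply: ball_open; rewrite invr_gt0.
  apply: bigcap_measurableType => j _.
  by apply: measurableC; apply: measurable_open_borel; apply: ball_open; rewrite invr_gt0.
pose g n (p : borel V * X) := h (s (k n p.1)) p.2.
apply: (@measurable_fun_cvg _ _ _ _ g) => [n|[f x] _].
  move=> _ C mC; rewrite setTI.
  have -> : g n @^-1` C = \bigcup_i ([set f | k n f = i] `*` (h (s i) @^-1` C)).
    apply/seteqP; split => [[f x] /= gC|[f x] [i _ [/= <-]]//].
    by exists (k n f).
  apply: bigcupT_measurable => i; apply: measurableX; first exact: mk.
  by rewrite -[X in measurable X]setTI; exact: mh.
have sc : s (k n f) @[n --> \oo] --> f.
  apply/cvgrPdist_lt => e e0; near=> n.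
  have : ball (s (k n f)) n.+1%:R^-1 f by rewrite /k; case: ex_minnP => i /asboolP.
  rewrite -ball_normE /= distrC => /lt_trans; apply.
  rewrite -[ltRHS]invrK ltf_pV2 ?posrE ?invr_gt0//.
  near: n; apply: filterS (nbhs_infty_gtr e^-1) => n /lt_le_trans; apply.
  by rewrite ler_nat.
exact: (cvg_comp _ _ sc (ch x f)).
Unshelve. all: by end_near. Qed.

End borel_normed.

(** * Orthonormal systems and projections *)

Section orthonormal.
Context d (T : measurableType d) (R : realType) (P : {measure set T -> \bar R}).

Definition orthonormal n (e : 'I_n -> T -> R) :=
  (forall i, sqint P (e i)) /\ forall i j, dotp P (e i) (e j) = (i == j)%:R.

Lemma dotp_sumr n (a : 'I_n -> R) (f : 'I_n -> T -> R) h :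
  (forall i, sqint P (f i)) -> sqint P h ->
  dotp P h (fun x => \sum_i a i * f i x) = \sum_i a i * dotp P h (f i).
Proof.
by move=> sf sh; rewrite dotpC dotp_suml//; apply: eq_bigr => i _; rewrite dotpC.
Qed.

Lemma dotp_orthonormal n (e : 'I_n -> T -> R) (a b : 'I_n -> R) : orthonormal e ->
  dotp P (fun x => \sum_i a i * e i x) (fun x => \sum_i b i * e i x) = \sum_i a i * b i.
Proof.
move=> [se oe]; rewrite dotp_suml//; last exact: sqint_lin.
apply: eq_bigr => i _; rewrite dotp_sumr// (bigD1 i)//= oe eqxx mulr1 big1 ?addr0// => j ji.
by rewrite oe eq_sym (negbTE ji) mulr0.
Qed.

Lemma dotp_sub_orthonormal n (e : 'I_n -> T -> R) (a : 'I_n -> R) f : orthonormal e ->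
  sqint P f ->
  dotp P (fun x => f x - \sum_i a i * e i x) (fun x => f x - \sum_i a i * e i x) =
  dotp P f f - 2 * \sum_i a i * dotp P f (e i) + \sum_i a i ^+ 2.
Proof.
move=> oe sf; have [se _] := oe.
rewrite dotpBB//; last exact: sqint_lin.
by rewrite dotp_sumr// dotp_orthonormal.
Qed.

Lemma dotp_sub_proj n (e : 'I_n -> T -> R) (a : 'I_n -> R) f : orthonormal e ->
  sqint P f ->
  dotp P (fun x => f x - \sum_i a i * e i x) (fun x => f x - \sum_i a i * e i x) =
  dotp P (fun x => f x - \sum_i dotp P f (e i) * e i x)
         (fun x => f x - \sum_i dotp P f (e i) * e i x) + \sum_i (dotp P f (e i) - a i) ^+ 2.
Proof.
move=> oe sf; rewrite !dotp_sub_orthonormal//.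
have -> : \sum_i (dotp P f (e i) - a i) ^+ 2 =
   \sum_i dotp P f (e i) * dotp P f (e i) - 2 * (\sum_i a i * dotp P f (e i)) + \sum_i a i ^+ 2.
  rewrite mulr_sumr -sumrB -big_split/=; apply: eq_bigr => i _; ring.
have -> : \sum_i dotp P f (e i) ^+ 2 = \sum_i dotp P f (e i) * dotp P f (e i).
  by apply: eq_bigr => i _; rewrite expr2.
ring.
Qed.

Lemma dotp_proj_orth n (e : 'I_n -> T -> R) f j : orthonormal e -> sqint P f ->
  dotp P (fun x => f x - \sum_i dotp P f (e i) * e i x) (e j) = 0.
Proof.
move=> oe sf; have [se oe'] := oe.
rewrite dotpBl//; last exact: sqint_lin.
rewrite dotp_suml// (bigD1 j)//= oe' eqxx mulr1 big1 ?addr0 ?subrr// => i ij.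
by rewrite oe' (negbTE ij) mulr0.
Qed.

(** [gram_orthonormalization] is applied to the Gram matrix. Its last equation, read on the
    diagonal, is Parseval's identity for [f i], so the residual has norm zero. Dependent functions
    merely make [r] smaller than [n]. *)
Lemma orthonormalization n (f : 'I_n -> T -> R) : (forall i, sqint P (f i)) ->
  exists r (Q : 'M[R]_(r, n)), let e k := fun x => \sum_i Q k i * f i x in
  [/\ (r <= n)%N, orthonormal e &
      forall i, {ae P, forall x, f i x = \sum_k dotp P (f i) (e k) * e k x}].
Proof.
move=> sf; pose G : 'M[R]_n := \matrix_(i, j) dotp P (f i) (f j).
have GE m (u v : 'M[R]_(m, n)) k l : (u *m G *m v^T) k l =
    dotp P (fun x => \sum_i u k i * f i x) (fun x => \sum_i v l i * f i x).
  rewrite dotp_suml//; last exact: sqint_lin.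
  under [RHS]eq_bigr do rewrite dotp_sumr//.
  rewrite -mulmxA mxE; apply: eq_bigr => i _; congr (_ * _).
  by rewrite mxE; apply: eq_bigr => j _; rewrite !mxE mulrC.
have pG : psd G.
  split; first by apply/matrixP => i j; rewrite !mxE dotpC.
  by move=> v; rewrite GE; exact: dotp_ge0.
have [r [Q [rn Q1 Q2]]] := gram_orthonormalization pG.
exists r, Q => e.
have oe : orthonormal e.
  split; first by move=> i; exact: sqint_lin.
  by move=> k l; rewrite -GE Q1 mxE.
split => // i.
have fe k : dotp P (f i) (e k) = (G *m Q^T) i k.
  by rewrite dotp_sumr// mxE; apply: eq_bigr => j _; rewrite !mxE mulrC.
have [se _] := oe.
have sd : sqint P (fun x => f i x - \sum_k dotp P (f i) (e k) * e k x).
  by apply: sqintB => //; exact: sqint_lin.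
suff : dotp P (fun x => f i x - \sum_k dotp P (f i) (e k) * e k x)
    (fun x => f i x - \sum_k dotp P (f i) (e k) * e k x) = 0.
  by move/(dotp0_ae sd); apply: filterS => x /eqP; rewrite subr_eq0 => /eqP.
rewrite dotp_sub_orthonormal//.
have -> : dotp P (f i) (f i) = \sum_k dotp P (f i) (e k) ^+ 2.
  have -> : dotp P (f i) (f i) = G i i by rewrite mxE.
  rewrite -Q2 -mulmxA mxE; apply: eq_bigr => k _; rewrite fe expr2; congr (_ * _).
  have -> : Q *m G = (G *m Q^T)^T by rewrite trmx_mul trmxK (proj1 pG).
  by rewrite mxE.
have -> : \sum_k dotp P (f i) (e k) * dotp P (f i) (e k) = \sum_k dotp P (f i) (e k) ^+ 2.
  by apply: eq_bigr => k _; rewrite expr2.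
ring.
Qed.

Lemma orthonormal_free n (e : 'I_n -> T -> R) (b : 'cV[R]_n) : orthonormal e ->
  {ae P, forall x, \sum_k b k 0 * e k x = 0} -> b = 0.
Proof.
move=> oe b0; have [se _] := oe.
have : dotp P (fun x => \sum_k b k 0 * e k x) (fun x => \sum_k b k 0 * e k x) = 0.
  rewrite (@dotp_ae _ _ _ _ _ _ (fun _ => 0) (fun _ => 0))//; [|exact: sqint_lin..|exact: sqint0|exact: sqint0].
  by rewrite /dotp; under eq_Rintegral do rewrite mulr0; rewrite Rintegral_cst// mul0r.
rewrite dotp_orthonormal// => /eqP; rewrite psumr_eq0 => [/allP b00|k _]; last by rewrite -expr2 sqr_ge0.
apply/colP => k; rewrite mxE; apply/eqP.
by have := b00 k (mem_index_enum _); rewrite /= mulf_eq0 orbb.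
Qed.

Lemma dotp_sum_le n (f : 'I_n -> T -> R) (a : 'I_n -> R) : (forall i, sqint P (f i)) ->
  dotp P (fun x => \sum_i a i * f i x) (fun x => \sum_i a i * f i x) <=
  n%:R * \sum_i a i ^+ 2 * dotp P (f i) (f i).
Proof.
move=> sf; rewrite dotp_suml//; last exact: sqint_lin.
have le i j : a i * (a j * dotp P (f i) (f j)) <=
    2^-1 * (a i ^+ 2 * dotp P (f i) (f i)) + 2^-1 * (a j ^+ 2 * dotp P (f j) (f j)).
  have si := sqintZ (a i) (sf i); have sj := sqintZ (a j) (sf j).
  have := dotp_ge0 P (fun x => a i * f i x - a j * f j x).
  rewrite dotpBB// !dotpZl// (dotpC P (f i) (fun x => a i * _)) (dotpC P (f j)) (dotpC P (f i) (fun x => a j * _)).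
  by rewrite !dotpZl// (dotpC P (f j) (f i)); lra.
apply: (@le_trans _ _ (\sum_i \sum_j (2^-1 * (a i ^+ 2 * dotp P (f i) (f i)) +
    2^-1 * (a j ^+ 2 * dotp P (f j) (f j))))).
  apply: ler_sum => i _; rewrite dotp_sumr// mulr_sumr; apply: ler_sum => j _; exact: le.
set A := (fun i => a i ^+ 2 * dotp P (f i) (f i)).
rewrite (eq_bigr (fun i => n%:R * 2^-1 * A i + 2^-1 * \sum_j A j)); last first.
  move=> i _; rewrite big_split/= sumr_const card_ord -mulr_sumr; congr (_ + _).
  by rewrite -[LHS]mulr_natl mulrA.
rewrite big_split/= -mulr_sumr sumr_const card_ord -[X in _ + X]mulr_natl.
by rewrite le_eqVlt; apply/orP; left; apply/eqP; field.
Qed.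

End orthonormal.

(** * Gaussian processes with square integrable paths *)

Section gaussian_model.
Context (R : realType) dO (Om : measurableType dO) (P : probability Om R)
  dX (X : measurableType dX) (nu : probability X R) (xi : X -> Om -> R)
  (E : set (Om -> R)).

(* [E] plays the role of the continuous linear functionals on the function
   space [Om], [xi x] is the evaluation at [x], [P] the Gaussian measure. *)
Record gaussian_model : Prop := GaussianModel {
  gm_meas : measurable_fun setT (fun p : Om * X => xi p.2 p.1) ;
  gm_lin : forall n (a : 'I_n -> R) (e : 'I_n -> Om -> R),
    (forall i, E (e i)) -> E (fun w => \sum_i a i * e i w) ;
  gm_eval : forall x, E (xi x) ;
  gm_sqint : forall e, E e -> sqint P e ;
  gm_law : forall e e', E e -> E e' -> dotp P e e = dotp P e' e' ->
    forall A : set R, measurable A -> P (e @^-1` A) = P (e' @^-1` A) ;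
  gm_path : forall w, sqint nu (xi^~ w) ;
  gm_int : forall eta, sqint nu eta -> E (fun w => dotp nu eta (xi^~ w)) }.

Hypothesis gm : gaussian_model.

Let sE e : E e -> sqint P e. Proof. exact: gm_sqint. Qed.

Lemma gmZ a e : E e -> E (fun w => a * e w).
Proof.
move=> Ee; rewrite (_ : (fun w => a * e w) = (fun w => \sum_(i < 1) a * e w)).
  exact: (@gm_lin gm 1 (fun _ => a) (fun _ => e)).
by apply/funext => w; rewrite big_ord1.
Qed.

Lemma gmD e f : E e -> E f -> E (fun w => e w + f w).
Proof.
move=> Ee Ef; rewrite (_ : (fun w => _) =
    (fun w => \sum_(i < 2) 1 * (if i == ord0 then e else f) w)).
  by apply: (@gm_lin gm 2 (fun _ => 1)) => i; case: ifP.
by apply/funext => w; rewrite !big_ord_recl big_ord0 /= !mul1r addr0.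
Qed.

Lemma gmB e f : E e -> E f -> E (fun w => e w - f w).
Proof.
move=> Ee Ef; rewrite (_ : (fun w => _) = (fun w => e w + (-1) * f w)).
  by apply: gmD => //; exact: gmZ.
by apply/funext => w; rewrite mulN1r.
Qed.

(* By the Cramer-Wold device (L, Z) and (L, -Z) have the same law, and
   (Z + psi)^2 + (- Z + psi)^2 >= 2 Z^2. *)
Lemma gaussian_lower_bound m (L : 'I_m -> Om -> R) Z (psi : m.-tuple R -> R) :
  (forall i, E (L i)) -> E Z -> (forall i, dotp P Z (L i) = 0) ->
  measurable_fun setT psi ->
  (\int[P]_w (Z w ^+ 2)%:E <= \int[P]_w ((Z w + psi [tuple L i w | i < m]) ^+ 2)%:E)%E.
Proof.
move=> EL EZ ZL mpsi.
have mL : measurable_fun setT (fun w => [tuple L i w | i < m]).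
  apply/measurable_fun_tnthP => i.
  rewrite (_ : _ \o _ = L i); first by case: (sE (EL i)).
  by apply/funext => w /=; rewrite tnth_mktuple.
have [mZ _] := sE EZ.
pose U (c : R) w : m.+1.-tuple R := [the _.-tuple R of (c * Z w) :: [tuple L i w | i < m]].
have mU c : measurable_fun setT (U c).
  by apply: measurable_cons => //; exact: measurable_funM.
have lawU (A : set (m.+1.-tuple R)) : measurable A -> P (U 1 @^-1` A) = P (U (-1) @^-1` A).
  apply: cramer_wold => // a B mB.
  pose B0 w := \sum_i a (lift ord0 i) * L i w.
  have EB0 : E B0 by exact: gm_lin.
  have E1 c : (fun w => \sum_i a i * tnth (U c w) i) = (fun w => (a ord0 * c) * Z w + B0 w).
    apply/funext => w; rewrite big_ord_recl tnth0 mulrA; congr (_ + _).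
    by apply: eq_bigr => i _; rewrite tnthS tnth_mktuple.
  have EU c : E (fun w => (a ord0 * c) * Z w + B0 w) by apply: gmD => //; exact: gmZ.
  have ZB0 : dotp P Z B0 = 0.
    rewrite dotp_sumr ?big1// => [i _|i|]; [by rewrite ZL mulr0|exact: sE|exact: sE].
  (* Since [Z] is uncorrelated with the [L i], the variance of a linear combination contains [c]
     only through its square; it is the same for c = 1 and c = -1, so [gm_law] gives equal
     one-dimensional laws. *)
  have dU c : dotp P (fun w => (a ord0 * c) * Z w + B0 w) (fun w => (a ord0 * c) * Z w + B0 w) =
      (a ord0 ^+ 2 * c ^+ 2) * dotp P Z Z + dotp P B0 B0.
    have sZ := sE EZ; have sB := sE EB0; have saZ := sqintZ (a ord0 * c) sZ.
    rewrite dotpDD// !dotpZl// ZB0 mulr0 mulr0 addr0 dotpC dotpZl//; ring.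
  have := @gm_law gm _ _ (EU 1) (EU (-1)); rewrite !dU sqrrN => /(_ erefl _ mB).
  by rewrite -!E1.
have msq : measurable_fun setT (fun t : m.+1.-tuple R => ((thead t + psi [tuple of behead t]) ^+ 2)%:E).
  apply/measurable_EFinP; apply: measurable_funX; apply: measurable_funD.
    exact: (measurable_tnth ord0).
  by apply: measurableT_comp => //; exact: measurable_behead.
have I12 := same_law_integral (mU 1) (mU (-1)) lawU msq (fun t => sqr_ge0 _ : (0 <= _%:E)%E).
have bt w : [tuple of behead (U 1 w)] = [tuple L i w | i < m] by exact: val_inj.
have bt' w : [tuple of behead (U (-1) w)] = [tuple L i w | i < m] by exact: val_inj.
have : (\int[P]_w (Z w ^+ 2)%:E + \int[P]_w (Z w ^+ 2)%:E <=
    \int[P]_w ((Z w + psi [tuple L i w | i < m]) ^+ 2)%:E +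
    \int[P]_w ((Z w + psi [tuple L i w | i < m]) ^+ 2)%:E)%E.
  have eq1 : (\int[P]_w ((Z w + psi [tuple L i w | i < m]) ^+ 2)%:E =
      \int[P]_w ((thead (U 1 w) + psi [tuple of behead (U 1 w)]) ^+ 2)%:E)%E.
    by apply: eq_integral => w _; rewrite bt theadE mul1r.
  have mZ2 : measurable_fun setT (fun w => (Z w ^+ 2)%:E) by apply/measurable_EFinP; exact: measurable_funX.
  have eq2 := etrans eq1 I12; rewrite [X in (_ <= X + _)%E]eq1 [X in (_ <= _ + X)%E]eq2.
  have mc c : measurable_fun setT (fun w => ((thead (U c w) + psi [tuple of behead (U c w)]) ^+ 2)%:E).
    exact: (measurableT_comp msq (mU c)).
  have p2 (x : R) : (0 <= (x ^+ 2)%:E)%E by rewrite lee_fin sqr_ge0.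
  rewrite -ge0_integralD// -ge0_integralD//.
  apply: ge0_le_integral => //.
  - by move=> w _; rewrite adde_ge0.
  - exact: emeasurable_funD.
  - exact: emeasurable_funD.
  move=> w _; rewrite bt bt' !theadE -!EFinD lee_fin mul1r.
  by set y := psi _; have := sqr_ge0 y; nra.
set a := (\int[P]_w (Z w ^+ 2)%:E)%E; set b := (\int[P]_w _)%E => ab.
rewrite leNgt; apply/negP => ba.
by move: ab; rewrite leNgt lteD.
Qed.

End gaussian_model.

(** * Tonelli for mean squares *)

Section joint_square.
Context (R : realType) dO (Om : measurableType dO) (P : probability Om R)
  dX (X : measurableType dX) (nu : probability X R).
Variable h : Om -> X -> R.
Hypothesis mh : measurable_fun setT (fun p : Om * X => h p.1 p.2).

Let mh2 : measurable_fun setT (fun p : Om * X => (h p.1 p.2 ^+ 2)%:E).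
Proof. by apply/measurable_EFinP; exact: measurable_funX. Qed.

Let h2 (p : Om * X) : (0 <= (h p.1 p.2 ^+ 2)%:E)%E.
Proof. by rewrite lee_fin sqr_ge0. Qed.

Lemma tonelli_sqr : (\int[P]_w \int[nu]_x (h w x ^+ 2)%:E = \int[nu]_x \int[P]_w (h w x ^+ 2)%:E)%E.
Proof. exact: (fubini_tonelli _ mh2 h2). Qed.

Lemma measurable_int_sqrF : measurable_fun setT (fun w => (\int[nu]_x (h w x ^+ 2)%:E)%E).
Proof. exact: (measurable_fun_fubini_tonelli_F _ mh2 h2). Qed.

Lemma measurable_int_sqrG : measurable_fun setT (fun x => (\int[P]_w (h w x ^+ 2)%:E)%E).
Proof. exact: (measurable_fun_fubini_tonelli_G _ mh2 h2). Qed.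

Lemma measurable_joint_w w : measurable_fun setT (h w).
Proof. exact: (measurableT_comp mh (pair1_measurable w)). Qed.

End joint_square.

(** * No algorithm beats a projection *)

Section projection_lower_bound.
Context (R : realType) dO (Om : measurableType dO) (P : probability Om R)
  dX (X : measurableType dX) (nu : probability X R) (xi : X -> Om -> R)
  (E : set (Om -> R)).
Hypothesis gm : gaussian_model P nu xi E.

Let sE e : E e -> sqint P e. Proof. by move=> Ee; exact: (gm_sqint gm Ee). Qed.

Lemma measurable_lift_x (f : X -> R) : measurable_fun setT f ->
  measurable_fun setT (fun p : Om * X => f p.2).
Proof. by move=> mf; exact: (measurableT_comp mf measurable_snd). Qed.

Lemma measurable_lift_w (f : Om -> R) : measurable_fun setT f ->
  measurable_fun setT (fun p : Om * X => f p.1).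
Proof. by move=> mf; exact: (measurableT_comp mf measurable_fst). Qed.

(** By polarization the covariance is a combination of integrals of squares, whose measurability in
    [x] comes from Tonelli. *)
Lemma measurable_dotp_eval e : E e -> measurable_fun setT (fun x => dotp P (xi x) e).
Proof.
move=> Ee; have [me _] := sE Ee.
have mD : measurable_fun setT (fun p : Om * X => xi p.2 p.1 + e p.1).
  by apply: measurable_funD; [exact: gm_meas gm|exact: measurable_lift_w].
have N2 f : sqint P f -> dotp P f f = fine (\int[P]_w (f w ^+ 2)%:E).
  by move=> sf; rewrite integral_sqr.
rewrite (_ : (fun x => _) = (fun x => 2^-1 * (fine (\int[P]_w ((xi x w + e w) ^+ 2)%:E) -
    fine (\int[P]_w (xi x w ^+ 2)%:E) - dotp P e e))).
  apply: measurable_funM => //; apply: measurable_funB => //; apply: measurable_funB.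
    by apply: measurableT_comp => //; exact: (measurable_int_sqrG P (h := fun w x => xi x w + e w)).
  by apply: measurableT_comp => //; apply: (measurable_int_sqrG P (h := fun w x => xi x w)); exact: gm_meas gm.
apply/funext => x; have sx := sE (gm_eval gm x); have se := sE Ee.
rewrite -!N2//; last exact: sqintD.
by rewrite dotpDD//; field.
Qed.

(* Almost every path of the remainder [xi - sum_k c k * L k] is in L2(nu), and
   enough paths of [L] are available to solve for the [c k]. *)
Lemma sqint_coefficients r (L : 'I_r -> Om -> R) (c : 'I_r -> X -> R) :
  orthonormal P L -> (forall k, measurable_fun setT (c k)) ->
  (\int[P]_w \int[nu]_x ((xi x w - \sum_k c k x * L k w) ^+ 2)%:E < +oo)%E ->
  forall k, sqint nu (c k).
Proof.
move=> oL mc fin; have [sL _] := oL.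
have mL k : measurable_fun setT (L k) by case: (sL k).
pose S := [set v : 'rV[R]_r | exists2 w, v = \row_k L k w &
  sqint nu (fun x => \sum_k L k w * c k x)].
have mg : measurable_fun setT (fun p : Om * X => xi p.2 p.1 - \sum_k c k p.2 * L k p.1).
  apply: measurable_funB; first exact: gm_meas gm.
  apply: measurable_sum => k; apply: measurable_funM.
    exact: measurable_lift_x.
  exact: measurable_lift_w.
have mF := measurable_int_sqrF nu (h := fun w x => xi x w - \sum_k c k x * L k w) mg.
have aeS : {ae P, forall w, sqint nu (fun x => \sum_k L k w * c k x)}.
  have intF : P.-integrable setT
      (fun w => (\int[nu]_x ((xi x w - \sum_k c k x * L k w) ^+ 2)%:E)%E).
    apply/integrableP; split => //; congr (_ < _)%E: fin.
    apply: eq_integral => w _; rewrite gee0_abs//.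
    by apply: integral_ge0 => x _; rewrite lee_fin sqr_ge0.
  have := integrable_ae measurableT intF; apply: filterS => w /(_ Logic.I) finw.
  have sg : sqint nu (fun x => xi x w - \sum_k c k x * L k w).
    split; first exact: (measurable_joint_w (h := fun w x => xi x w - \sum_k c k x * L k w) mg).
    by rewrite ltey; apply: contraTneq finw => ->.
  apply: eq_sqint (sqintB (gm_path gm w) sg) => x.
  rewrite (_ : _ - (_ - _) = \sum_k c k x * L k w); last by ring.
  by apply: eq_bigr => k _; rewrite mulrC.
(* A vector [b] annihilating the rows of [S] annihilates almost every value of [L], so it vanishes
   because [L] is orthonormal. Hence [r] good paths give an invertible system for the [c k]. *)
have [b Sb|M [Mu SM]] := @spanning_rows _ _ S.
  apply: (orthonormal_free oL); apply: filterS aeS => w sw.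
  have := Sb (\row_k L k w) (ex_intro2 _ _ w erefl sw) => /matrixP/(_ 0 0).
  rewrite mxE [RHS]mxE => H; rewrite -[RHS]H.
  by apply: eq_bigr => k _; rewrite mxE mulrC.
move=> k; have sM i : sqint nu (fun x => \sum_k M i k * c k x).
  have [w Mw sw] := SM i; apply: eq_sqint sw => x; apply: eq_bigr => l _.
  by move/rowP : Mw => /(_ l); rewrite !mxE => ->.
apply: eq_sqint (sqint_lin (fun i => invmx M k i) sM) => x.
pose cx := \col_l c l x.
have -> : c k x = (invmx M *m (M *m cx)) k 0 by rewrite mulKmx// mxE.
rewrite mxE; apply: eq_bigr => i _; congr (_ * _).
by rewrite mxE; apply: eq_bigr => l _; rewrite !mxE.
Qed.

(** Two orthonormalizations. In L2(P) the functionals become [e], and at fixed [x] their best use is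
    the regression with coefficients [c k x], whose residual is uncorrelated with every [L i]. In
    L2(nu) the coefficients become [eta], and projecting each path onto their span can only lower
    the error. Each [eta j] combines covariances with [xi x], so it vanishes where all paths do. *)
Lemma projection_lower_bound m (L : 'I_m -> Om -> R) (phi : m.-tuple R -> X -> R) :
  (forall i, E (L i)) ->
  measurable_fun setT (fun p : m.-tuple R * X => phi p.1 p.2) ->
  (\int[P]_w \int[nu]_x ((xi x w - phi [tuple L i w | i < m] x) ^+ 2)%:E < +oo)%E ->
  exists p (eta : 'I_p -> X -> R), [/\ (p <= m)%N, orthonormal nu eta,
    forall x, (forall w, xi x w = 0) -> forall j, eta j x = 0 &
    (\int[P]_w \int[nu]_x ((xi x w - \sum_j dotp nu (xi^~ w) (eta j) * eta j x) ^+ 2)%:E <=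
     \int[P]_w \int[nu]_x ((xi x w - phi [tuple L i w | i < m] x) ^+ 2)%:E)%E].
Proof.
move=> EL mphi; set err := (\int[P]_w _)%E => errfin.
have sL i := sE (EL i).
have [r [Q [rm oe Le]]] := orthonormalization sL.
set e := (fun k x => \sum_i Q k i * L i x) in oe Le.
have Ee k : E (e k) by exact: (gm_lin gm (Q k) EL).
have [se _] := oe.
pose c k x := dotp P (xi x) (e k).
have mc k : measurable_fun setT (c k) by exact: measurable_dotp_eval.
pose g w x := xi x w - \sum_k c k x * e k w.
have mg : measurable_fun setT (fun p : Om * X => g p.1 p.2).
  apply: measurable_funB; first exact: gm_meas gm.
  apply: measurable_sum => k; apply: measurable_funM.
    exact: measurable_lift_x.
  by apply: measurable_lift_w; case: (se k).
have mL : measurable_fun setT (fun w => [tuple L i w | i < m]).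
  apply/measurable_fun_tnthP => i.
  rewrite (_ : _ \o _ = L i); first by case: (sL i).
  by apply/funext => w /=; rewrite tnth_mktuple.
have mphi' : measurable_fun setT (fun p : Om * X => xi p.2 p.1 - phi [tuple L i p.1 | i < m] p.2).
  apply: measurable_funB; first exact: gm_meas gm.
  apply: (measurableT_comp mphi (g := fun p : Om * X => ([tuple L i p.1 | i < m], p.2))).
  apply/measurable_fun_pairP; split; last exact: measurable_snd.
  exact: (measurableT_comp mL measurable_fst).
have g_err : (\int[P]_w \int[nu]_x (g w x ^+ 2)%:E <= err)%E.
  rewrite /err (tonelli_sqr P nu mg) (tonelli_sqr P nu (h := fun w x => xi x w - phi [tuple L i w | i < m] x) mphi').
  apply: ge0_le_integral => //.
  - by move=> x _; apply: integral_ge0 => w _; rewrite lee_fin sqr_ge0.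
  - exact: measurable_int_sqrG.
  - exact: (measurable_int_sqrG P (h := fun w x => xi x w - phi [tuple L i w | i < m] x)).
  move=> x _.
  have Eg : E (g^~ x).
    by apply: (gmB gm); [exact: (gm_eval gm x)|exact: (gm_lin gm (fun k => c k x) Ee)].
  (* The regression and [phi] both depend on [w] only through the values of [L]; their difference is
     the [psi] of [gaussian_lower_bound]. *)
  pose psi (t : m.-tuple R) := \sum_k c k x * \sum_i Q k i * tnth t i - phi t x.
  have -> : (\int[P]_w ((xi x w - phi [tuple L i w | i < m] x) ^+ 2)%:E =
      \int[P]_w ((g w x + psi [tuple L i w | i < m]) ^+ 2)%:E)%E.
    apply: eq_integral => w _; congr ((_ ^+ 2)%:E); rewrite /g /psi addrA; congr (_ - _).
    rewrite -addrA; apply/eqP; rewrite eq_sym -subr_eq0 addrAC subrr add0r addrC subr_eq0.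
    apply/eqP; apply: eq_bigr => k _; congr (_ * _); apply: eq_bigr => i _.
    by rewrite tnth_mktuple.
  apply: (gaussian_lower_bound gm) => //.
  (* Almost surely [L i] is a combination of the [e k], to which the residual [g] is orthogonal. *)
  - move=> i; have sg := sE Eg.
    rewrite (@dotp_ae _ _ _ _ _ (L i) (g^~ x) (fun w => \sum_k dotp P (L i) (e k) * e k w))//.
    + rewrite dotp_sumr// big1// => k _.
      by rewrite (dotp_proj_orth k oe (sE (gm_eval gm x))) mulr0.
    + exact: sqint_lin.
    + exact: aeW.
  - apply: measurable_funB.
      apply: measurable_sum => k; apply: measurable_funM => //.
      by apply: measurable_sum => i; apply: measurable_funM => //; exact: measurable_tnth.
    exact: (measurableT_comp mphi (pair2_measurable x)).
have sc : forall k, sqint nu (c k).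
  by apply: (sqint_coefficients oe mc); exact: le_lt_trans errfin.
have [p [Q' [pr oeta ceta]]] := orthonormalization sc.
set eta := (fun k x => \sum_i Q' k i * c i x) in oeta ceta.
have [seta _] := oeta.
exists p, eta; split; [exact: leq_trans pr rm|exact: oeta| |].
  move=> x x0 j; rewrite /eta big1// => i _; rewrite /c /dotp.
  by under eq_Rintegral do rewrite x0 mul0r; rewrite Rintegral_cst// mul0r mulr0.
have Edot k : E (fun w => dotp nu (xi^~ w) (eta k)).
  rewrite (_ : (fun w => _) = (fun w => dotp nu (eta k) (xi^~ w))); first exact: gm_int gm _ (seta k).
  by apply/funext => w; rewrite dotpC.
apply: (le_trans _ g_err); apply: ge0_le_integral => //.
- by move=> w _; apply: integral_ge0 => x _; rewrite lee_fin sqr_ge0.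
- apply: (measurable_int_sqrF nu (h := fun w x => xi x w - \sum_j dotp nu (xi^~ w) (eta j) * eta j x)).
  apply: measurable_funB; first exact: gm_meas gm.
  apply: measurable_sum => k; apply: measurable_funM.
    exact: (measurable_lift_w (proj1 (sE (Edot k)))).
  exact: (measurable_lift_x (proj1 (seta k))).
- exact: (measurable_int_sqrF nu mg).
move=> w _.
have sx := gm_path gm w.
have sg : sqint nu (g w).
  apply: sqintB => //; apply: (@eq_sqint _ _ _ _ (fun x => \sum_k e k w * c k x)).
    by move=> x; apply: eq_bigr => k _; rewrite mulrC.
  exact: sqint_lin.
have sB (a : 'I_p -> R) : sqint nu (fun x => xi x w - \sum_j a j * eta j x).
  by apply: sqintB => //; exact: sqint_lin.
rewrite !integral_sqr// lee_fin.
(* The regression, seen as a function of [x], has these coordinates in [eta]; the projection of the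
   path has the best ones. *)
pose a j := \sum_k e k w * dotp nu (c k) (eta j).
have gae : {ae nu, forall x, g w x = xi x w - \sum_j a j * eta j x}.
  have call : {ae nu, forall x, forall k, c k x = \sum_j dotp nu (c k) (eta j) * eta j x}.
    exact: filter_forall.
  apply: filterS call => x cx; rewrite /g; congr (_ - _).
  under eq_bigr => k _ do rewrite cx mulr_suml.
  rewrite exchange_big/=; apply: eq_bigr => j _; rewrite /a mulr_suml.
  by apply: eq_bigr => k _; ring.
rewrite (@dotp_ae _ _ _ _ (g w) (g w) (fun x => xi x w - \sum_j a j * eta j x)
   (fun x => xi x w - \sum_j a j * eta j x))//.
by rewrite (dotp_sub_proj a oeta sx) lerDl sumr_ge0// => j _; exact: sqr_ge0.
Qed.

End projection_lower_bound.

(** * A point no worse than the weighted mean *)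

Section mean_value.
Context (R : realType) dX (X : measurableType dX) (nu : probability X R).

(** If G > K wherever u > 0, then u (G - K) is nonnegative with integral at most 0, so it vanishes
    almost everywhere, and u with it, against its integral 1. The condition [0 < u y] will place the
    chosen node in [D]. *)
Lemma exists_le_weighted_mean (u G : X -> R) (K : R) :
  measurable_fun setT u -> measurable_fun setT G ->
  (forall y, 0 <= u y) -> (forall y, 0 <= G y) ->
  (\int[nu]_y (u y)%:E = 1)%E -> (\int[nu]_y (u y * G y)%:E <= K%:E)%E ->
  exists y, 0 < u y /\ G y <= K.
Proof.
move=> mu mG u0 G0 u1 uG; apply: contrapT => /forallNP N.
have GK y : 0 < u y -> K < G y.
  by move=> uy; have /not_andP[//|/negP] := N y; rewrite -ltNge.
have K0 : 0 <= K.
  rewrite -lee_fin; apply: le_trans uG; apply: integral_ge0 => y _.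
  by rewrite lee_fin mulr_ge0.
have f0 y : 0 <= u y * (G y - K).
  have := u0 y; rewrite le_eqVlt => /predU1P[<-|uy]; first by rewrite mul0r.
  by rewrite mulr_ge0// subr_ge0 ltW// GK.
have mf : measurable_fun setT (fun y => (u y * (G y - K))%:E).
  by apply/measurable_EFinP; apply: measurable_funM => //; exact: measurable_funB.
have mu' : measurable_fun setT (fun y => (u y)%:E) by exact/measurable_EFinP.
have f00 : (\int[nu]_y (u y * (G y - K))%:E = 0)%E.
  apply/eqP; rewrite eq_le integral_ge0 ?andbT; last by move=> y _; rewrite lee_fin.
  have : (\int[nu]_y (u y * (G y - K))%:E + K%:E <= 0 + K%:E)%E.
    rewrite add0e (le_trans _ uG)//.
    have -> : K%:E = (\int[nu]_y (K%:E * (u y)%:E))%E.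
      by rewrite ge0_integralZl// ?u1 ?mule1// => y _; rewrite lee_fin.
    rewrite -ge0_integralD//; last 3 first.
    - by move=> y _; rewrite lee_fin.
    - by move=> y _; rewrite mule_ge0 ?lee_fin.
    - exact: emeasurable_funM.
    apply: ge0_le_integral => //.
    - by move=> y _; rewrite adde_ge0 ?mule_ge0 ?lee_fin.
    - by apply: emeasurable_funD => //; exact: emeasurable_funM.
    - by apply/measurable_EFinP; exact: measurable_funM.
    - by move=> y _; rewrite -EFinM -EFinD lee_fin; lra.
  by rewrite leeD2rE.
have : (\int[nu]_y `|(u y * (G y - K))%:E| = 0)%E.
  by rewrite -[RHS]f00; apply: eq_integral => y _; rewrite gee0_abs// lee_fin.
move/ae_eq_integral_abs => /(_ measurableT mf) fae.
have : (\int[nu]_y (u y)%:E = 0)%E.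
  rewrite -(@integral0 _ _ _ nu setT); apply: ae_eq_integral => //.
  apply: filterS fae => y /(_ Logic.I) /= [] /eqP; rewrite mulf_eq0 => /orP[/eqP -> //|].
  rewrite subr_eq0 => /eqP GyK _; have := u0 y; rewrite le_eqVlt => /predU1P[<- //|/GK].
  by rewrite GyK ltxx.
by rewrite u1 => /eqP; rewrite eqe oner_eq0.
Qed.

End mean_value.

(** * Recovering the coefficients from samples *)

Section evaluation_sampling.
Context (R : realType) dO (Om : measurableType dO) (P : probability Om R)
  dX (X : measurableType dX) (nu : probability X R) (xi : X -> Om -> R)
  (E : set (Om -> R)).
Hypothesis gm : gaussian_model P nu xi E.
Context p (eta : 'I_p -> X -> R) (D : set X).
Hypothesis oeta : orthonormal nu eta.
Hypothesis etaD : forall x j, ~ D x -> eta j x = 0.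

Let sE e : E e -> sqint P e. Proof. by move=> Ee; exact: (gm_sqint gm Ee). Qed.
Let seta j : sqint nu (eta j). Proof. by case: oeta. Qed.
Let meta j : measurable_fun setT (eta j). Proof. by case: (seta j). Qed.

Let w j om := dotp nu (xi^~ om) (eta j).

Let Ew j : E (w j).
Proof.
rewrite (_ : w j = (fun om => dotp nu (eta j) (xi^~ om))); first exact: (gm_int gm (seta j)).
by apply/funext => om; rewrite /w dotpC.
Qed.

Let rem (l : 'I_p -> Om -> R) om x := xi x om - \sum_j l j om * eta j x.

Let mrem l : (forall j, E (l j)) -> measurable_fun setT (fun q : Om * X => rem l q.1 q.2).
Proof.
move=> El; apply: measurable_funB; first exact: gm_meas gm.
apply: measurable_sum => j; apply: measurable_funM.
  exact: (measurable_lift_w (proj1 (sE (El j)))).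
exact: (measurable_lift_x (meta j)).
Qed.

Let srem l om : sqint nu (rem l om).
Proof. by apply: sqintB; [exact: (gm_path gm om)|exact: sqint_lin]. Qed.

Let Erem l x : (forall j, E (l j)) -> E ((rem l)^~ x).
Proof.
move=> El; apply: (gmB gm); first exact: (gm_eval gm x).
rewrite (_ : (fun _ => _) = (fun om => \sum_j eta j x * l j om)).
  exact: (gm_lin gm (fun j => eta j x) El).
by apply/funext => om; apply: eq_bigr => j _; rewrite mulrC.
Qed.

Lemma error_decomposition l : (forall j, E (l j)) ->
  (\int[P]_om \int[nu]_x ((xi x om - \sum_j l j om * eta j x) ^+ 2)%:E =
   \int[P]_om \int[nu]_x ((xi x om - \sum_j dotp nu (xi^~ om) (eta j) * eta j x) ^+ 2)%:E +
   (\sum_j dotp P (fun om => dotp nu (xi^~ om) (eta j) - l j om)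
      (fun om => dotp nu (xi^~ om) (eta j) - l j om))%:E)%E.
Proof.
move=> El.
transitivity (\int[P]_om (\int[nu]_x (rem w om x ^+ 2)%:E + \sum_j ((w j om - l j om) ^+ 2)%:E))%E.
  apply: eq_integral => om _; rewrite -/(rem l om) -/(rem w om).
  rewrite (integral_sqr (srem l om)) (integral_sqr (srem w om)) sumEFin -EFinD; congr EFin.
  exact: (dotp_sub_proj _ oeta (gm_path gm om)).
have ms j : measurable_fun setT (fun om => ((w j om - l j om) ^+ 2)%:E).
  apply/measurable_EFinP; apply: measurable_funX; apply: measurable_funB.
    exact: (proj1 (sE (Ew j))).
  exact: (proj1 (sE (El j))).
have s0 j om : (0 <= ((w j om - l j om) ^+ 2)%:E)%E by rewrite lee_fin sqr_ge0.
rewrite ge0_integralD//; last 4 first.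
- by move=> om _; apply: integral_ge0 => x _; rewrite lee_fin sqr_ge0.
- exact: (measurable_int_sqrF nu (mrem Ew)).
- by move=> om _; apply: sume_ge0.
- exact: emeasurable_sum.
congr (_ + _)%E; rewrite ge0_integral_sum//= -sumEFin.
apply: eq_bigr => j _; rewrite integral_sqr//.
by apply: sE; apply: (gmB gm).
Qed.

(** The normalized Christoffel function of the span of [eta]: where u > 0, the ratios eta_j^2 / u
    sum to exactly p, whatever the basis functions are. *)
Let u y := p%:R^-1 * \sum_j eta j y ^+ 2.

Let mu : measurable_fun setT u.
Proof. by apply: measurable_funM => //; apply: measurable_sum => j; exact: measurable_funX. Qed.

Let u_ge0 y : 0 <= u y.
Proof. by rewrite mulr_ge0 ?invr_ge0// sumr_ge0// => j _; exact: sqr_ge0. Qed.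

Let eta_u0 y j : u y = 0 -> (0 < p)%N -> eta j y = 0.
Proof.
move=> /eqP; rewrite mulf_eq0 invr_eq0 pnatr_eq0 => /orP[/eqP -> //|].
rewrite psumr_eq0 => [/allP /(_ j (mem_index_enum _))|i _]; last exact: sqr_ge0.
by rewrite /= sqrf_eq0 => /eqP.
Qed.

Let eta_sqr_integral j : (\int[nu]_y (eta j y ^+ 2)%:E = 1)%E.
Proof. by rewrite integral_sqr//; case: oeta => _ ->; rewrite eqxx. Qed.

Let u_integral : (0 < p)%N -> (\int[nu]_y (u y)%:E = 1)%E.
Proof.
move=> p0; rewrite /u.
transitivity (\int[nu]_y ((p%:R^-1)%:E * \sum_j (eta j y ^+ 2)%:E))%E.
  by apply: eq_integral => y _; rewrite sumEFin -EFinM.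
have me2 j : measurable_fun setT (fun y => (eta j y ^+ 2)%:E).
  by apply/measurable_EFinP; exact: measurable_funX.
have e20 j y : (0 <= (eta j y ^+ 2)%:E)%E by rewrite lee_fin sqr_ge0.
have mS : measurable_fun setT (fun y => \sum_j (eta j y ^+ 2)%:E)%E by exact: emeasurable_sum.
have S0 y : (0 <= \sum_j (eta j y ^+ 2)%:E)%E by apply: sume_ge0.
rewrite ge0_integralZl ?lee_fin ?invr_ge0//.
rewrite ge0_integral_sum//; under eq_bigr do rewrite eta_sqr_integral.
rewrite (sumEFin _ _ (fun _ => 1)) sumr_const card_ord -EFinM mulVf//.
by rewrite pnatr_eq0 -lt0n.
Qed.

(** Importance sampling: the factor 1/u makes the one-node estimate unbiased, which yields the cross
    term with [w j om - l j om], and the ratios eta_j^2 / u give the factor p. The bound is an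
    inequality because of the set where u vanishes, on which [H] is zero. *)
Let pathwise_bound l om (a : 'I_p -> R) (H : 'I_p -> X -> R) : (0 < p)%N ->
  (forall j y, H j y = Num.sqrt (u y) * (a j + eta j y / u y * rem l om y)) ->
  (forall j, measurable_fun setT (H j)) ->
  (\int[nu]_y \sum_j (H j y ^+ 2)%:E <=
   (\sum_j (a j ^+ 2 + 2 * a j * (w j om - l j om)))%:E +
   p%:R%:E * \int[nu]_y (rem l om y ^+ 2)%:E)%E.
Proof.
move=> p0 HE mH; have sr := srem l om.
pose A := \sum_j a j ^+ 2.
pose al y := \sum_j a j * eta j y.
have sal : sqint nu al by exact: sqint_lin.
pose B y := A * u y + 2 * (al y * rem l om y) + p%:R * (rem l om y * rem l om y).
have HB y : \sum_j H j y ^+ 2 <= B y.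
  have := u_ge0 y; rewrite le_eqVlt => /predU1P[u0|uy].
    rewrite big1 ?/B => [|j _]; last by rewrite HE -u0 sqrtr0 mul0r expr0n.
    rewrite -u0 mulr0 add0r /al big1 => [|j _]; last by rewrite eta_u0// mulr0.
    by rewrite mul0r mulr0 add0r mulr_ge0// -expr2 sqr_ge0.
  rewrite le_eqVlt; apply/orP; left; apply/eqP; rewrite /B /A /al.
  have -> : p%:R * (rem l om y * rem l om y) =
      \sum_j eta j y ^+ 2 / u y * (rem l om y * rem l om y).
    rewrite -!mulr_suml; congr (_ * _).
    have -> : \sum_j eta j y ^+ 2 = p%:R * u y.
      by rewrite /u mulrA mulfV ?mul1r// pnatr_eq0 -lt0n.
    by rewrite mulfK// gt_eqF.
  rewrite !mulr_suml mulr_sumr -!big_split/=; apply: eq_bigr => j _.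
  rewrite HE exprMn sqr_sqrtr//; field.
  by rewrite gt_eqF.
have iu : nu.-integrable setT (EFin \o u).
  apply/integrableP; split; first exact/measurable_EFinP.
  under eq_integral do rewrite /= ger0_norm//.
  by rewrite u_integral// ltry.
have ial := sqint_mul sal sr.
have irr := sqint_mul sr sr.
have i1 : nu.-integrable setT (EFin \o (fun y => A * u y)) by exact: (integrableZl measurableT A iu).
have i2 : nu.-integrable setT (EFin \o (fun y => 2 * (al y * rem l om y))).
  exact: (integrableZl measurableT 2 ial).
have i3 : nu.-integrable setT (EFin \o (fun y => p%:R * (rem l om y * rem l om y))).
  exact: (integrableZl measurableT p%:R irr).
have i12 : nu.-integrable setT (EFin \o (fun y => A * u y + 2 * (al y * rem l om y))).
  exact: (integrableD measurableT i1 i2).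
have iB : nu.-integrable setT (EFin \o B) by exact: (integrableD measurableT i12 i3).
have mH2 j : measurable_fun setT (fun y => (H j y ^+ 2)%:E).
  by apply/measurable_EFinP; exact: measurable_funX.
apply: (@le_trans _ _ (\int[nu]_y (B y)%:E)%E).
  apply: ge0_le_integral => //.
  - by move=> y _; apply: sume_ge0 => j _; rewrite lee_fin sqr_ge0.
  - exact: emeasurable_sum.
  - exact: measurable_int iB.
  - by move=> y _; rewrite sumEFin lee_fin.
rewrite -[leLHS]fineK; last exact: integrable_fin_num.
rewrite integral_sqr// -EFinM -EFinD lee_fin -/(Rintegral nu setT B) /B.
rewrite RintegralD// RintegralD// (RintegralZl A measurableT iu).
rewrite (RintegralZl 2 measurableT ial) (RintegralZl p%:R measurableT irr).
have -> : \int[nu]_y u y = 1 by rewrite /Rintegral u_integral.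
rewrite mulr1 lerD2r le_eqVlt; apply/orP; left; apply/eqP.
rewrite big_split/= -/A; congr (_ + _); rewrite -/(dotp nu al (rem l om)).
rewrite dotp_suml// mulr_sumr; apply: eq_bigr => j _; rewrite -mulrA; congr (_ * (_ * _)).
rewrite dotpC /rem dotpBl//; last 2 first.
  exact: (gm_path gm om).
  exact: sqint_lin.
congr (_ - _); rewrite dotp_suml//; case: oeta => _ oe.
rewrite (bigD1 j)//= oe eqxx mulr1 big1 ?addr0// => i ij.
by rewrite oe (negbTE ij) mulr0.
Qed.


Let measurable_invu : measurable_fun setT (fun y => (u y)^-1).
Proof.
rewrite (_ : (fun _ => _) = (fun y => u y `^ (-1))).
  exact: (measurableT_comp (measurable_powR (-1)) mu).
by apply/funext => y; rewrite powR_inv1.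
Qed.

(** For a random node with density [u], the estimates [q j * rem l om y] have mean [w j om - l j om]
    along each path, so the cross terms with the error [s] accumulated so far cancel and only a
    variance of at most p e is added. Some fixed node does at least as well as this mean. *)
Let sampling_step l (s : 'I_p -> Om -> R) (e : R) : (0 < p)%N ->
  (forall j, E (l j)) -> (forall j, E (s j)) ->
  (\int[P]_om \int[nu]_y (rem l om y ^+ 2)%:E <= e%:E)%E ->
  exists y (q : 'I_p -> R), D y /\
    \sum_j dotp P (fun om => s j om + (q j * rem l om y - (w j om - l j om)))
                  (fun om => s j om + (q j * rem l om y - (w j om - l j om))) <=
    \sum_j dotp P (s j) (s j) + p%:R * e.
Proof.
move=> p0 El Es le.
pose F j y om := s j om + (eta j y / u y * rem l om y - (w j om - l j om)).
have EF j y : E (F j y).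
  apply: (gmD gm) => //; apply: (gmB gm); last exact: (gmB gm).
  by apply: (gmZ gm); exact: Erem.
pose G y := \sum_j dotp P (F j y) (F j y).
(* The square root puts the density inside the square, so Tonelli for squares applies. *)
pose H j om y := Num.sqrt (u y) * F j y om.
have mFj j : measurable_fun setT (fun q : Om * X => F j q.2 q.1).
  have mE f : E f -> measurable_fun setT (fun q : Om * X => f q.1).
    by move=> Ef; exact: (measurable_lift_w (proj1 (sE Ef))).
  apply: measurable_funD; first exact: mE.
  apply: measurable_funB; last by apply: (mE (fun om => w j om - l j om)); exact: (gmB gm).
  apply: measurable_funM; last exact: mrem.
  apply: (measurable_lift_x (f := fun y => eta j y / u y)).
  exact: measurable_funM.
have mH j : measurable_fun setT (fun q : Om * X => H j q.1 q.2).
  apply: measurable_funM; last exact: mFj.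
  apply: (measurable_lift_x (f := fun y => Num.sqrt (u y))).
  apply: measurableT_comp mu; apply: continuous_measurable_fun; exact: sqrt_continuous.
have mG : measurable_fun setT G.
  apply: measurable_sum => j.
  rewrite (_ : (fun _ => _) = (fun y => fine (\int[P]_om (F j y om ^+ 2)%:E))).
    apply: measurableT_comp => //.
    exact: (measurable_int_sqrG P (h := fun om y => F j y om)).
  by apply/funext => y; rewrite integral_sqr//; exact: sE.
have uG : (\int[nu]_y (u y * G y)%:E <= (\sum_j dotp P (s j) (s j) + p%:R * e)%:E)%E.
  have -> : (\int[nu]_y (u y * G y)%:E = \int[P]_om \int[nu]_y \sum_j (H j om y ^+ 2)%:E)%E.
    transitivity (\sum_j \int[nu]_y \int[P]_om (H j om y ^+ 2)%:E)%E.
      rewrite -ge0_integral_sum//; last 2 first.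
      - move=> j; exact: (measurable_int_sqrG P (mH j)).
      - by move=> j y _; apply: integral_ge0 => om _; rewrite lee_fin sqr_ge0.
      apply: eq_integral => y _; rewrite mulr_sumr -sumEFin; apply: eq_bigr => j _.
      have sF := sE (EF j y).
      rewrite (@integral_sqr _ _ _ P (fun om => H j om y)); last exact: sqintZ.
      rewrite dotpZl//; last exact: sqintZ.
      by rewrite dotpC dotpZl// mulrA -expr2 sqr_sqrtr.
    under eq_bigr => j _ do rewrite -(tonelli_sqr P nu (mH j)).
    rewrite -ge0_integral_sum//; last 2 first.
    - move=> j; exact: (measurable_int_sqrF nu (mH j)).
    - by move=> j om _; apply: integral_ge0 => y _; rewrite lee_fin sqr_ge0.
    apply: eq_integral => om _; rewrite ge0_integral_sum//.
    - move=> j; apply/measurable_EFinP; apply: measurable_funX.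
      exact: (measurable_joint_w (mH j)).
    - by move=> j y _; rewrite lee_fin sqr_ge0.
  apply: (@le_trans _ _ (\int[P]_om (\sum_j (s j om ^+ 2)%:E + p%:R%:E * \int[nu]_y (rem l om y ^+ 2)%:E))%E).
    have mS : measurable_fun setT (fun om => \sum_j (s j om ^+ 2)%:E)%E.
      by apply: emeasurable_sum => j; apply/measurable_EFinP; apply: measurable_funX; case: (sE (Es j)).
    have mI := measurable_int_sqrF nu (mrem El).
    apply: ge0_le_integral => //.
    - by move=> om _; apply: integral_ge0 => y _; apply: sume_ge0 => j _; rewrite lee_fin sqr_ge0.
    - rewrite (_ : (fun _ => _) = (fun om => \sum_j \int[nu]_y (H j om y ^+ 2)%:E)%E).
        by apply: emeasurable_sum => j; exact: (measurable_int_sqrF nu (mH j)).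
      apply/funext => om; rewrite ge0_integral_sum//.
      + move=> j; apply/measurable_EFinP; apply: measurable_funX.
        exact: (measurable_joint_w (mH j)).
      + by move=> j y _; rewrite lee_fin sqr_ge0.
    - by apply: emeasurable_funD => //; exact: measurable_funeM.
    move=> om _; apply: le_trans (@pathwise_bound l om (fun j => s j om - (w j om - l j om)) (fun j => H j om) p0 _ _) _.
    - by move=> j y; rewrite /H /F; congr (_ * _); ring.
    - move=> j; exact: (measurable_joint_w (mH j)).
    rewrite leeD2r// sumEFin lee_fin; apply: ler_sum => j _.
    (* The cross term: (a - v)^2 + 2 (a - v) v = a^2 - v^2, which is at most a^2. *)
    set a := s j om; set v := w j om - l j om.
    by have := sqr_ge0 v; rewrite -subr_ge0 => ?; nra.
  have mS j : measurable_fun setT (fun om => (s j om ^+ 2)%:E).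
    by apply/measurable_EFinP; apply: measurable_funX; case: (sE (Es j)).
  have s0 j om : (0 <= (s j om ^+ 2)%:E)%E by rewrite lee_fin sqr_ge0.
  have I0 om : (0 <= \int[nu]_y (rem l om y ^+ 2)%:E)%E.
    by apply: integral_ge0 => y _; rewrite lee_fin sqr_ge0.
  have mI := measurable_int_sqrF nu (mrem El).
  have mIp : measurable_fun setT (fun om => p%:R%:E * \int[nu]_y (rem l om y ^+ 2)%:E)%E.
    exact: measurable_funeM.
  have mSS : measurable_fun setT (fun om => \sum_j (s j om ^+ 2)%:E)%E by exact: emeasurable_sum.
  have SS0 om : (0 <= \sum_j (s j om ^+ 2)%:E)%E by apply: sume_ge0.
  have Ip0 om : (0 <= p%:R%:E * \int[nu]_y (rem l om y ^+ 2)%:E)%E by rewrite mule_ge0 ?lee_fin.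
  rewrite ge0_integralD// EFinD ge0_integral_sum// ge0_integralZl ?lee_fin//.
  rewrite -sumEFin; apply: leeD.
    by apply: lee_sum => j _; rewrite integral_sqr//; exact: sE.
  by rewrite EFinM lee_wpmul2l ?lee_fin.
have [y [uy Gy]] := exists_le_weighted_mean mu mG u_ge0 (fun y => sumr_ge0 _ (fun j _ => dotp_ge0 P _)) (u_integral p0) uG.
exists y, (fun j => eta j y / u y); split => //.
apply: contrapT => nDy; move: uy; rewrite /u big1 ?mulr0 ?ltxx// => j _.
by rewrite (etaD _ nDy) expr0n.
Qed.

(** Nodes form a sequence of which the first [N] count, so that appending a node changes a function
    and not a type. *)
Definition evals_span (pts : nat -> X) N (f : Om -> R) :=
  exists a : nat -> R, forall om, f om = \sum_(i < N) a i * xi (pts i) om.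

Lemma evals_spanD pts N f g : evals_span pts N f -> evals_span pts N g ->
  evals_span pts N (fun om => f om + g om).
Proof.
move=> [a fa] [b gb]; exists (fun i => a i + b i) => om.
by rewrite fa gb -big_split/=; apply: eq_bigr => i _; rewrite mulrDl.
Qed.

Lemma evals_spanZ pts N c f : evals_span pts N f -> evals_span pts N (fun om => c * f om).
Proof.
move=> [a fa]; exists (fun i => c * a i) => om.
by rewrite fa mulr_sumr; apply: eq_bigr => i _; rewrite mulrA.
Qed.

Lemma eq_evals_span pts N f g : f =1 g -> evals_span pts N f -> evals_span pts N g.
Proof. by move=> /funext ->. Qed.

Lemma evals_span0 pts N : evals_span pts N (fun _ => 0).
Proof. by exists (fun _ => 0) => om; rewrite big1// => i _; rewrite mul0r. Qed.

Lemma evals_span_sum pts N n (c : 'I_n -> R) (f : 'I_n -> Om -> R) :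
  (forall i, evals_span pts N (f i)) -> evals_span pts N (fun om => \sum_i c i * f i om).
Proof.
elim: n c f => [|n IH] c f sf.
  by apply: eq_evals_span (evals_span0 pts N) => om; rewrite big_ord0.
apply: eq_evals_span (evals_spanD (evals_spanZ (c ord_max) (sf ord_max))
  (IH (fun i => c (widen_ord (leqnSn n) i)) _ (fun i => sf (widen_ord (leqnSn n) i)))) => om.
by rewrite big_ord_recr/= addrC.
Qed.

Lemma evals_span_extend pts N y f : evals_span pts N f ->
  evals_span (fun i => if (i < N)%N then pts i else y) N.+1 f.
Proof.
move=> [a fa]; exists (fun i => if (i < N)%N then a i else 0) => om.
rewrite big_ord_recr/= !ltnn mul0r addr0 fa; apply: eq_bigr => i _.
by rewrite ltn_ord.
Qed.

Lemma evals_span_last pts N y :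
  evals_span (fun i => if (i < N)%N then pts i else y) N.+1 (xi y).
Proof.
exists (fun i => (i == N)%:R) => om.
rewrite big_ord_recr/= ltnn eqxx mul1r big1 ?add0r// => i _.
by rewrite ltn_eqF// mul0r.
Qed.

Lemma evals_span_E pts N f : evals_span pts N f -> E f.
Proof.
move=> [a fa]; rewrite (_ : f = (fun om => \sum_(i < N) a i * xi (pts i) om)).
  by apply: (gm_lin gm (fun i : 'I_N => a i)) => i; exact: (gm_eval gm).
exact/funext.
Qed.

Definition sampled N (c : R) := exists pts : nat -> X, (forall i, (i < N)%N -> D (pts i)) /\
  exists l : 'I_p -> Om -> R, (forall j, evals_span pts N (l j)) /\
    \sum_j dotp P (fun om => dotp nu (xi^~ om) (eta j) - l j om)
                  (fun om => dotp nu (xi^~ om) (eta j) - l j om) <= c.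

Variable beta : R.
Hypothesis beta_ub : (\int[P]_om \int[nu]_x
  ((xi x om - \sum_j dotp nu (xi^~ om) (eta j) * eta j x) ^+ 2)%:E <= beta%:E)%E.

(* One Monte Carlo correction with [n] nodes drawn from the density
   [p^-1 * sum_j (eta j)^2], derandomized node by node. *)
Lemma sampled_correction N n c : (0 < p)%N -> (0 < n)%N -> sampled N c ->
  sampled (N + n) (p%:R / n%:R * (beta + c)).
Proof.
move=> p0 n0 [pts [Dpts [l [sl lc]]]].
have El j : E (l j) by exact: evals_span_E (sl j).
pose e := beta + c.
have le : (\int[P]_om \int[nu]_y (rem l om y ^+ 2)%:E <= e%:E)%E.
  by rewrite (error_decomposition El) EFinD leeD.
(* [t] is the sum of [k] one-node estimates. Its deviation from [k] times the coefficient error has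
   a second moment linear in [k]. *)
have H k : exists pts' : nat -> X, (forall i, (i < N + k)%N -> D (pts' i)) /\
    (forall j, evals_span pts' (N + k) (l j)) /\
    exists t : 'I_p -> Om -> R, (forall j, evals_span pts' (N + k) (t j)) /\
      \sum_j dotp P (fun om => t j om - k%:R * (w j om - l j om))
                    (fun om => t j om - k%:R * (w j om - l j om)) <= k%:R * (p%:R * e).
  elim: k => [|k [pts' [Dp [sl' [t [st tk]]]]]].
    exists pts; rewrite addn0; split => //; split => //.
    exists (fun _ _ => 0); split; first by move=> j; exact: evals_span0.
    rewrite mul0r big1// => j _.
    rewrite (_ : (fun om => _) = (fun=> 0)); last by apply/funext => om; rewrite mul0r subr0.
    by rewrite /dotp; under eq_Rintegral do rewrite mulr0; rewrite Rintegral_cst// mul0r.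
  have Es j : E (fun om => t j om - k%:R * (w j om - l j om)).
    apply: (gmB gm); first exact: evals_span_E (st j).
    by apply: (gmZ gm); exact: (gmB gm).
  have [y [q [Dy yq]]] := sampling_step p0 El Es le.
  exists (fun i => if (i < N + k)%N then pts' i else y); rewrite addnS; split.
    by move=> i _; case: ifP => [/Dp|].
  split; first by move=> j; exact: evals_span_extend.
  exists (fun j om => t j om + q j * rem l om y); split.
    move=> j; apply: evals_spanD; first exact: evals_span_extend.
    apply: evals_spanZ; apply: (@eq_evals_span _ _ (fun om => xi y om + (-1) * \sum_i eta i y * l i om)).
      by move=> om; rewrite mulN1r; congr (_ - _); apply: eq_bigr => i _; rewrite mulrC.
    apply: evals_spanD; first exact: evals_span_last.
    apply: evals_spanZ; apply: evals_span_sum => i; exact: evals_span_extend.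
  have -> : k.+1%:R * (p%:R * e) = k%:R * (p%:R * e) + p%:R * e by rewrite -natr1; ring.
  apply: le_trans (lerD tk (lexx (p%:R * e))); apply: le_trans yq; rewrite le_eqVlt; apply/orP; left; apply/eqP.
  apply: eq_bigr => j _; congr (dotp P); apply/funext => om; rewrite -natr1; ring.
have [pts' [Dp [sl' [t [st tk]]]]] := H n.
exists pts'; split => //.
(* The average of the [n] estimates is added to [l]; dividing the bound n p e by n^2 leaves p e /
   n. *)
exists (fun j om => l j om + n%:R^-1 * t j om); split.
  by move=> j; apply: evals_spanD => //; exact: evals_spanZ.
have n0' : (n%:R : R) != 0 by rewrite pnatr_eq0 -lt0n.
have nn : 0 < (n%:R : R) ^+ 2 by rewrite exprn_gt0// ltr0n.
rewrite -(ler_pM2l nn) mulr_sumr.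
have -> : n%:R ^+ 2 * (p%:R / n%:R * (beta + c)) = n%:R * (p%:R * e) by rewrite /e; field.
apply: le_trans tk; rewrite le_eqVlt; apply/orP; left; apply/eqP; apply: eq_bigr => j _.
have Et := evals_span_E (st j).
have Ed : E (fun om => t j om - n%:R * (w j om - l j om)).
  by apply: (gmB gm) => //; apply: (gmZ gm); exact: (gmB gm).
rewrite -/(w j _) (_ : (fun om => dotp nu (xi^~ om) (eta j) - _) =
    (fun om => - n%:R^-1 * (t j om - n%:R * (w j om - l j om)))); last first.
  by apply/funext => om; rewrite -/(w j om); field.
have sd := sE Ed; have sd' := sqintZ (- n%:R^-1) sd.
by rewrite dotpZl// dotpC dotpZl//; field.
Qed.

(* Interpolation at Fekete points for the basis [eta], weighted by the inverse
   of the standard deviation of the remainder; the [theta] term only keeps the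
   weight bounded. *)
Lemma sampled_fekete theta : (0 < p)%N -> 0 < theta ->
  sampled p (4 * p%:R ^+ 2 * (beta + theta * p%:R)).
Proof.
move=> p0 th0.
(* The variance of the remainder at [x]; by Tonelli its integral is the projection error, at most
   [beta]. *)
pose b x := dotp P ((rem w)^~ x) ((rem w)^~ x).
pose U x := \sum_j eta j x ^+ 2.
pose bt x := b x + theta * U x.
have sh x : sqint P ((rem w)^~ x) by apply: sE; exact: Erem.
have b0 x : 0 <= b x by exact: dotp_ge0.
have U0 x : 0 <= U x by apply: sumr_ge0 => j _; exact: sqr_ge0.
have bt0 x : 0 < U x -> 0 < bt x by move=> Ux; rewrite ltr_wpDl// mulr_gt0.
have bt_ge0 x : 0 <= bt x by rewrite addr_ge0// mulr_ge0// ltW.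
have etaU j x : eta j x ^+ 2 <= U x.
  by rewrite /U (bigD1 j)//= lerDl sumr_ge0// => i _; exact: sqr_ge0.
have mb : measurable_fun setT (fun x => (b x)%:E).
  rewrite (_ : (fun _ => _) = (fun x => \int[P]_om (rem w om x ^+ 2)%:E)%E).
    exact: (measurable_int_sqrG P (mrem Ew)).
  by apply/funext => x; rewrite integral_sqr.
have bt_int : (\int[nu]_x (bt x)%:E <= (beta + theta * p%:R)%:E)%E.
  have mU : measurable_fun setT (fun x => (U x)%:E).
    by apply/measurable_EFinP; apply: measurable_sum => j; exact: measurable_funX.
  have -> : (\int[nu]_x (bt x)%:E = \int[nu]_x ((b x)%:E + theta%:E * (U x)%:E))%E by [].
  rewrite ge0_integralD//; last 3 first.
  - by move=> x _; rewrite lee_fin.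
  - by move=> x _; rewrite mule_ge0 ?lee_fin// ltW.
  - exact: measurable_funeM.
  rewrite EFinD; apply: leeD.
    apply: le_trans beta_ub; rewrite le_eqVlt; apply/orP; left; apply/eqP.
    rewrite (tonelli_sqr P nu (mrem Ew)).
    by apply: eq_integral => x _; rewrite integral_sqr.
  rewrite ge0_integralZl ?lee_fin//; [|by move=> x _; rewrite lee_fin|exact: ltW].
  rewrite EFinM lee_wpmul2l ?lee_fin ?(ltW th0)//.
  rewrite /U; under eq_integral do rewrite -sumEFin.
  rewrite ge0_integral_sum//; last 2 first.
  - by move=> j; apply/measurable_EFinP; exact: measurable_funX.
  - by move=> j x _; rewrite lee_fin sqr_ge0.
  under eq_bigr do rewrite eta_sqr_integral.
  by rewrite (sumEFin _ _ (fun _ => 1)) sumr_const card_ord.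
pose row_of x : 'rV[R]_p := \row_j (eta j x / Num.sqrt (bt x)).
pose S := [set v | exists2 x, 0 < U x & v = row_of x].
have [|c Sc|M [Mu SM Mle]] := @fekete_rows _ p S (Num.sqrt theta^-1).
(* Since eta_j^2 is at most U and [bt] at least theta U, the entries of the rows are bounded by
   theta^(-1/2), as the existence of near-optimal determinants requires. *)
- move=> v j [x Ux ->]; rewrite mxE normrM normfV (ger0_norm (sqrtr_ge0 _)).
  rewrite ler_pdivrMr ?sqrtr_gt0 ?bt0// -sqrtrM ?invr_ge0 ?(ltW th0)//.
  rewrite -sqrtr_sqr ler_wsqrtr// ler_pdivlMl//.
  rewrite /bt; apply: le_trans (_ : theta * U x <= _); last by rewrite lerDr.
  by rewrite ler_pM2l.
- apply: (orthonormal_free oeta); apply: aeW => x.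
  have := U0 x; rewrite le_eqVlt => /predU1P[Ux|Ux].
    rewrite big1// => j _; suff -> : eta j x = 0 by rewrite mulr0.
    by apply/eqP; rewrite -sqrf_eq0 eq_le sqr_ge0 andbT [leRHS]Ux etaU.
  have := Sc _ (ex_intro2 _ _ x Ux erefl) => /matrixP/(_ 0 0); rewrite mxE [RHS]mxE => H.
  have nz : Num.sqrt (bt x) != 0 by rewrite gt_eqF// sqrtr_gt0 bt0.
  apply: (mulfI (invr_neq0 nz)); rewrite mulr0 -[RHS]H mulr_sumr.
  by apply: eq_bigr => j _; rewrite mxE; ring.
have /choice [f fM] : forall i, exists x, 0 < U x /\ row i M = row_of x.
  by move=> i; have [x] := SM i; exists x.
pose sb i := Num.sqrt (bt (f i)).
have sb0 i : 0 < sb i by rewrite sqrtr_gt0; apply: bt0; case: (fM i).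
have MiE i j : M i j = eta j (f i) / sb i.
  by have [_ /rowP/(_ j)] := fM i; rewrite !mxE.
pose ga j i := invmx M j i / sb i.
exists (fun n => oapp f (f (Ordinal p0)) (insub n)); split.
  move=> n np; rewrite insubT/=; apply: contrapT => nD.
  have [+ _] := fM (Sub n np); rewrite /U big1 ?ltxx// => j _.
  by rewrite (etaD _ nD) expr0n.
exists (fun j om => \sum_i ga j i * xi (f i) om); split.
  move=> j; exists (fun n => oapp (ga j) 0 (insub n)) => om.
  by apply: eq_bigr => i _; rewrite valK.
(* Interpolation reproduces the span of [eta], so the error in a coefficient is minus the
   coefficient of the interpolated remainder. *)
have interp j om : w j om - \sum_i ga j i * xi (f i) om = - \sum_i ga j i * rem w om (f i).
  apply/eqP; rewrite subr_eq addrC -sumrB; apply/eqP.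
  transitivity (\sum_i \sum_k ga j i * (w k om * eta k (f i))); last first.
    by apply: eq_bigr => i _; rewrite /rem -mulr_sumr; ring.
  rewrite exchange_big/=.
  transitivity (\sum_k w k om * (invmx M *m M) j k).
    rewrite mulVmx// (bigD1 j)//= mxE eqxx mulr1 big1 ?addr0// => k kj.
    by rewrite mxE eq_sym (negbTE kj) mulr0.
  apply: eq_bigr => k _; rewrite mxE mulr_sumr; apply: eq_bigr => i _.
  by rewrite MiE /ga; ring.
(* The column sum is the squared L2(nu) norm of the i-th Lagrange function, which the choice of [M]
   bounds pointwise by twice the square root of [bt]. *)
have col_bound i : \sum_j invmx M j i ^+ 2 <= 4 * (beta + theta * p%:R).
  have -> : \sum_j invmx M j i ^+ 2 = \sum_j invmx M j i * invmx M j i.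
    by apply: eq_bigr => j _; rewrite expr2.
  rewrite -(dotp_orthonormal (fun j => invmx M j i) (fun j => invmx M j i) oeta).
  have sl : sqint nu (fun x => \sum_j invmx M j i * eta j x) by exact: sqint_lin.
  rewrite -lee_fin -integral_sqr// EFinM.
  apply: (@le_trans _ _ (\int[nu]_x (4%:E * (bt x)%:E))%E); last first.
    rewrite ge0_integralZl ?lee_fin//; first by rewrite lee_wpmul2l ?lee_fin.
    - apply/measurable_EFinP; apply: measurable_funD; first exact/measurable_EFinP.
      by apply: measurable_funM => //; apply: measurable_sum => j; exact: measurable_funX.
    - by move=> x _; rewrite lee_fin.
  apply: ge0_le_integral => //.
  - by move=> x _; rewrite lee_fin sqr_ge0.
  - by apply/measurable_EFinP; apply: measurable_funX; case: sl.
  - apply: measurable_funeM; apply/measurable_EFinP; apply: measurable_funD; first exact/measurable_EFinP.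
    by apply: measurable_funM => //; apply: measurable_sum => j; exact: measurable_funX.
  move=> x _; rewrite -EFinM lee_fin.
  have := U0 x; rewrite le_eqVlt => /predU1P[Ux|Ux].
    rewrite big1 ?expr0n ?mulr_ge0// => j _; suff -> : eta j x = 0 by rewrite mulr0.
    by apply/eqP; rewrite -sqrf_eq0 eq_le sqr_ge0 andbT [leRHS]Ux etaU.
  have := Mle _ i (ex_intro2 _ _ x Ux erefl).
  have sx : 0 < Num.sqrt (bt x) by rewrite sqrtr_gt0 bt0.
  have -> : (row_of x *m invmx M) 0 i = (\sum_j invmx M j i * eta j x) / Num.sqrt (bt x).
    by rewrite mxE mulr_suml; apply: eq_bigr => j _; rewrite mxE; ring.
  rewrite normrM normfV (gtr0_norm sx) ler_pdivrMr// => H.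
  rewrite -[leLHS]real_normK ?num_real// -[X in 4 * X]sqr_sqrtr//.
  rewrite (_ : 4 * _ = (2 * Num.sqrt (bt x)) ^+ 2); last by ring.
  by rewrite lerXn2r// nnegrE// mulr_ge0// ltW.
(* One factor p comes from Cauchy-Schwarz over the nodes, the other from summing [col_bound] over
   them; the weight 1 / [sb i] cancels the variance of the remainder at the node [f i]. *)
apply: (@le_trans _ _ (\sum_j p%:R * \sum_i invmx M j i ^+ 2)).
  apply: ler_sum => j _.
  rewrite (_ : (fun om => _) = (fun om => - \sum_i ga j i * rem w om (f i))); last first.
    by apply/funext => om; exact: interp.
  have sg : sqint P (fun om => \sum_i ga j i * rem w om (f i)).
    by apply: (sqint_lin (fun i => ga j i) (fun i => sh (f i))).
  have sg' := sqintN sg.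
  rewrite dotpNl// dotpC dotpNl// opprK.
  apply: le_trans (dotp_sum_le (fun i => ga j i) (fun i => sh (f i))) _.
  rewrite ler_pM2l ?ltr0n//; apply: ler_sum => i _.
  rewrite -/(b (f i)) /ga exprMn -mulrA ler_piMr ?sqr_ge0//.
  rewrite exprVn ler_pdivrMl ?exprn_gt0// mulr1 sqr_sqrtr//.
  by rewrite /bt lerDl mulr_ge0// ltW.
rewrite -mulr_sumr exchange_big/=.
apply: (@le_trans _ _ (p%:R * \sum_(i < p) (4 * (beta + theta * p%:R)))).
  by rewrite ler_pM2l ?ltr0n//; apply: ler_sum => i _; exact: col_bound.
rewrite sumr_const card_ord -[X in _ * X]mulr_natl le_eqVlt; apply/orP; left; apply/eqP; ring.
Qed.

End evaluation_sampling.

(** * Sampling rate and the resulting algorithm *)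

Section evaluation_algorithm.
Context (R : realType).

Lemma measurable_not_empty dX (X : measurableType dX) (nu : probability X R) : exists x : X, True.
Proof.
apply: contrapT => /forallNP N.
have := @probability_setT _ _ _ nu.
rewrite (_ : setT = set0) ?measure0; last by apply/seteqP; split => x // _; case: (N x).
by move/eqP; rewrite eqe eq_sym oner_eq0.
Qed.

(** The constant must be fixed before all data. With q = p/n the errors obey c' = q (beta + c); as
    2q is at most 1, they stay below (2q + (2q)^k 4p^2) S, and both summands become small multiples
    of th S. *)
Lemma sampled_rate (om th : R) : 0 < om -> 0 < th <= 1 -> exists C : R, 0 < C /\
  forall dO (Om : measurableType dO) (P : probability Om R)
    dX (X : measurableType dX) (nu : probability X R) (xi : X -> Om -> R)
    (E : set (Om -> R)) (p m : nat) (eta : 'I_p -> X -> R) (D : set X) (beta S : R),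
  gaussian_model P nu xi E -> orthonormal nu eta -> (forall x j, ~ D x -> eta j x = 0) ->
  (\int[P]_w \int[nu]_x
    ((xi x w - \sum_j dotp nu (xi^~ w) (eta j) * eta j x) ^+ 2)%:E <= beta%:E)%E ->
  (p <= m)%N -> beta < S ->
  exists N, N%:R <= C * (m%:R + 1) `^ (1 + om) /\ sampled P nu xi eta D N (th * S).
Proof.
move=> om0 /andP[th0 th1].
(* The number of corrections: M^(- om K) must compensate the factor M^2 of the Fekete start. *)
have [K [K0 Kom]] : exists K : nat, (0 < K)%N /\ 2 <= om * K%:R.
  exists (Num.truncn (2 / om)).+1; split => //.
  rewrite mulrC -ler_pdivrMr// ltW//.
  by have /andP[] := truncn_itv (ltW (divr_gt0 (ltr0n R 2) om0 : 0 < 2%:R / om)).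
(* The Fekete nodes number at most Y = M^(1 + om), and each of the K corrections uses at most (16/th
   + 1) Y nodes. *)
exists (1 + K%:R * (16 / th + 1)).
have C0 : 0 <= K%:R * (16 / th + 1).
  by rewrite mulr_ge0// addr_ge0// divr_ge0// ltW.
split; first by rewrite ltr_pwDl.
move=> dO Om P dX X nu xi E p m eta D beta S gm oeta etaD betaP pm bS.
have beta0 : 0 <= beta.
  rewrite -lee_fin (le_trans _ betaP)//; apply: integral_ge0 => w _.
  by apply: integral_ge0 => x _; rewrite lee_fin sqr_ge0.
have S0 : 0 < S by exact: le_lt_trans bS.
have sampled_mono N c c' : c <= c' -> sampled P nu xi eta D N c -> sampled P nu xi eta D N c'.
  move=> cc [pts [Dp [l [sl lc]]]]; exists pts; split => //; exists l; split => //.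
  exact: le_trans lc cc.
have [p0|p0] := posnP p.
  subst p; exists 0%N; split.
    by rewrite mulr_ge0 ?powR_ge0// addr_ge0.
  have [x0 _] := measurable_not_empty nu.
  exists (fun _ => x0); split => //; exists (fun _ _ => 0); split; first by case.
  by rewrite big_ord0 mulr_ge0// ltW.
set M := m%:R + 1 : R.
have M1 : 1 <= M by rewrite /M lerDr.
have M0 : 0 < M by exact: lt_le_trans M1.
set Y := M `^ (1 + om).
have YE : Y = M * M `^ om by rewrite /Y powRD ?powRr1 ?ltW// (gt_eqF M0) implybT.
have Mom1 : 1 <= M `^ om by rewrite -[leLHS](powRr0 M) ler_powR// ltW.
have YM : M <= Y by rewrite YE ler_peMr// ltW.
(* The factor 16 / th makes 2q at most th/8 times M^(- om); the final error is then at most (th/8 +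
   th/2) S. *)
pose n := (Num.truncn (16 * Y / th)).+1.
have Yth0 : 0 <= 16 * Y / th by rewrite divr_ge0 ?mulr_ge0 ?powR_ge0// ltW.
have /andP[n1 n2] := truncn_itv Yth0.
have n1' : n%:R <= 16 * Y / th + 1 by rewrite /n -natr1 lerD2r.
have n2' : 16 * Y / th < n%:R by [].
have n0 : 0 < n%:R :> R by rewrite ltr0n.
pose y := (M `^ om)^-1.
have y0 : 0 < y by rewrite invr_gt0 (lt_le_trans _ Mom1).
have y1 : y <= 1 by rewrite invf_le1 // (lt_le_trans _ Mom1).
pose q := p%:R / n%:R : R.
have q0 : 0 <= q by rewrite divr_ge0.
have pM : p%:R <= M by rewrite /M (le_trans (_ : _ <= m%:R)) ?ler_nat// lerDl.
have q2 : 2 * q <= th / 8 * y.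
  rewrite /q mulrA ler_pdivrMr// /y.
  apply: (@le_trans _ _ (2 * M)); first by rewrite ler_pM2l.
  apply: (@le_trans _ _ (th / 8 / M `^ om * (16 * Y / th))); last first.
    by rewrite ler_pM2l ?(ltW n2')// divr_gt0// ?divr_gt0// (lt_le_trans _ Mom1).
  rewrite YE le_eqVlt; apply/orP; left; apply/eqP; field.
  by rewrite !gt_eqF// (lt_le_trans _ Mom1).
have q21 : 2 * q <= 1.
  by apply: le_trans q2 _; apply: le_trans (_ : 1 * 1 <= _); [apply: ler_pM => //; lra|rewrite mulr1].
have iter k : sampled P nu xi eta D (p + k * n) ((2 * q + (2 * q) ^+ k * (4 * p%:R ^+ 2)) * S).
  elim: k => [|k IH].
    rewrite mul0n addn0 expr0 mul1r.
    (* With theta = (S - beta) / p the start is exactly 4 p^2 S. The strict inequality beta < S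
       makes theta positive, even when the projection error is zero. *)
    have := sampled_fekete gm oeta etaD betaP p0 (divr_gt0 (_ : 0 < S - beta) (_ : 0 < p%:R)).
    rewrite subr_gt0 bS ltr0n p0 => /(_ isT isT); apply: sampled_mono.
    rewrite divfK ?pnatr_eq0 -?lt0n// addrC subrK.
    by rewrite ler_wpM2r ?(ltW S0)// lerDr mulr_ge0.
  have := sampled_correction gm oeta etaD betaP p0 (ltn0Sn _ : (0 < n)%N) IH.
  rewrite -addnA mulSnr; apply: sampled_mono; rewrite -/q.
  set Z := (2 * q) ^+ k * (4 * p%:R ^+ 2).
  have -> : (2 * q) ^+ k.+1 * (4 * p%:R ^+ 2) = 2 * q * Z by rewrite exprS -mulrA.
  have Z0 : 0 <= Z by rewrite mulr_ge0 ?exprn_ge0 ?mulr_ge0// sqr_ge0.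
  apply: (@le_trans _ _ (q * (S + (2 * q + Z) * S))); first by rewrite ler_wpM2l// lerD2r ltW.
  rewrite -subr_ge0 (_ : _ - _ = S * q * ((1 - 2 * q) + Z)); last by ring.
  by rewrite mulr_ge0 ?mulr_ge0 ?(ltW S0)// addr_ge0// subr_ge0.
exists (p + K * n)%N; split.
  rewrite natrD natrM mulrDl mul1r; apply: lerD; first exact: le_trans pM YM.
  rewrite -mulrA ler_wpM2l//; apply: le_trans n1' _.
  rewrite (_ : (16 / th + 1) * Y = 16 * Y / th + Y); last by ring.
  by rewrite lerD2l (le_trans M1).
apply: sampled_mono (iter K); rewrite ler_wpM2r ?(ltW S0)//.
have qK : (2 * q) ^+ K * (4 * p%:R ^+ 2) <= th / 2.
  apply: (@le_trans _ _ ((th / 8 * y) ^+ K * (4 * M ^+ 2))).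
    apply: ler_pM; rewrite ?exprn_ge0 ?mulr_ge0 ?sqr_ge0//.
      by apply: lerXn2r; rewrite ?nnegrE// ?mulr_ge0// ?divr_ge0// ltW.
    by rewrite ler_pM2l// lerXn2r ?nnegrE// ltW.
  have yK : y ^+ K * M ^+ 2 <= 1.
    rewrite /y exprVn -(powR_mulrn K (powR_ge0 M om)) -powRrM.
    rewrite mulrC ler_pdivrMr ?powR_gt0// mul1r -(powR_mulrn 2 (ltW M0)).
    by rewrite ler_powR.
  have thK : (th / 8) ^+ K <= th / 8.
    rewrite -[leRHS]expr1 ler_wiXn2l//; lra.
  rewrite exprMn (_ : _ * _ = 4 * ((th / 8) ^+ K * (y ^+ K * M ^+ 2))); last by ring.
  apply: (@le_trans _ _ (4 * (th / 8 * 1))); last by lra.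
  rewrite ler_pM2l//; apply: ler_pM => //.
    by rewrite exprn_ge0// divr_ge0// ltW.
  by rewrite mulr_ge0 ?exprn_ge0// ltW.
have : 2 * q <= th / 8 by apply: le_trans q2 _; rewrite ler_piMr// divr_ge0// ltW.
lra.
Qed.

(** That [psi] vanishes for N = 0 matches the convention that no information means the zero
    algorithm; that it vanishes off [D] lets functions extended by zero stand for functions on
    [D]. *)
Theorem evaluation_algorithm (om th : R) : 0 < om -> 0 < th <= 1 -> exists C : R, 0 < C /\
  forall dO (Om : measurableType dO) (P : probability Om R)
    dX (X : measurableType dX) (nu : probability X R) (xi : X -> Om -> R)
    (E : set (Om -> R)) (D : set X) (m : nat)
    (L : 'I_m -> Om -> R) (phi : m.-tuple R -> X -> R) (S : R),
  gaussian_model P nu xi E -> (forall x w, ~ D x -> xi x w = 0) ->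
  (forall i, E (L i)) -> measurable_fun setT (fun q : m.-tuple R * X => phi q.1 q.2) ->
  (\int[P]_w \int[nu]_x ((xi x w - phi [tuple L i w | i < m] x) ^+ 2)%:E < S%:E)%E ->
  exists N (pts : 'I_N -> X) (psi : N.-tuple R -> X -> R),
   (forall t x, N = 0%N \/ ~ D x -> psi t x = 0) /\
   [/\ N%:R <= C * (m%:R + 1) `^ (1 + om), forall i, D (pts i),
     measurable_fun setT (fun q : N.-tuple R * X => psi q.1 q.2) &
     (\int[P]_w \int[nu]_x ((xi x w - psi [tuple xi (pts i) w | i < N] x) ^+ 2)%:E
       <= ((1 + th) * S)%:E)%E].
Proof.
move=> om0 th01; have [C [C0 HC]] := sampled_rate om0 th01.
exists C; split => // dO Om P dX X nu xi E D m L phi S gm xiD EL mphi errS.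
have [p [eta [pm oeta eta0 le]]] :=
  projection_lower_bound gm EL mphi (lt_trans errS (ltry S)).
have etaD x j : ~ D x -> eta j x = 0 by move=> nD; apply: eta0 => w; exact: xiD.
set B := (\int[P]_w _)%E in le.
have B0 : (0 <= B)%E.
  by apply: integral_ge0 => w _; apply: integral_ge0 => x _; rewrite lee_fin sqr_ge0.
have Bfin : B \is a fin_num.
  by rewrite ge0_fin_numE//; apply: le_lt_trans le _; exact: lt_trans errS (ltry _).
have Bbeta : (B <= (fine B)%:E)%E by rewrite (fineK Bfin).
have BS : fine B < S by rewrite -lte_fin (fineK Bfin); exact: le_lt_trans le errS.
have [N [NC [pts [Dp [l [sl lS]]]]]] := HC _ _ _ _ _ _ _ _ _ _ eta D _ _ gm oeta etaD Bbeta pm BS.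
have [seta _] := oeta.
have /choice [a la] := sl.
exists N, (fun i => pts i), (fun t x => \sum_j (\sum_(i < N) a j i * tnth t i) * eta j x).
split.
  move=> t x [N0|nD]; rewrite big1// => j _; last by rewrite etaD// mulr0.
  by move: t (a j); rewrite N0 => t aj; rewrite big_ord0 mul0r.
split => //.
- by move=> i; exact: Dp.
- apply: measurable_sum => j; apply: measurable_funM.
    apply: measurable_sum => i; apply: measurable_funM => //.
    exact: (measurableT_comp (measurable_tnth i) measurable_fst).
  by apply: (measurableT_comp (f := eta j)) => //; case: (seta j).
have El j : E (l j) by exact: (evals_span_E gm (sl j)).
have := error_decomposition gm oeta El.
rewrite -/B => H.
rewrite [leLHS](_ : _ = (\int[P]_om \int[nu]_x ((xi x om - \sum_j l j om * eta j x) ^+ 2)%:E)%E).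
  by rewrite H mulrDl mul1r EFinD; apply: leeD; [rewrite -[leLHS]fineK// lee_fin ltW|rewrite lee_fin].
apply: eq_integral => w _; apply: eq_integral => x _; congr ((_ ^+ 2)%:E); congr (_ - _).
apply: eq_bigr => j _; congr (_ * _); rewrite la; apply: eq_bigr => i _.
by rewrite tnth_mktuple.
Qed.

End evaluation_algorithm.

(** * The probability measure with a given density *)

Section density_probability.
Context d (T : measurableType d) (R : realType) (lam : {measure set T -> \bar R}) (g : T -> R).
Hypothesis mg : measurable_fun setT g.
Hypothesis g0 : forall x, 0 <= g x.
Hypothesis g1 : (\int[lam]_x (g x)%:E = 1)%E.

Lemma density_probability : exists nu : probability T R,
  forall A, measurable A -> nu A = (\int[lam]_(x in A) (g x)%:E)%E.
Proof.
pose nu0 (A : set T) : \bar R := (\int[lam]_(x in A) (g x)%:E)%E.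
have nu00 : nu0 set0 = 0%E by rewrite /nu0 integral_set0.
have nu0_ge0 A : (0 <= nu0 A)%E by apply: integral_ge0 => x _; rewrite lee_fin.
have meg : measurable_fun setT (EFin \o g) by exact/measurable_EFinP.
have nu0_sigma : semi_sigma_additive nu0.
  move=> F mF tF mUF; rewrite /nu0 ge0_integral_bigcup//.
  - by apply: is_cvg_ereal_nneg_natsum_cond => n _ _; exact: nu0_ge0.
  - exact: measurable_funTS.
  - by move=> x _; rewrite lee_fin.
have nu01 : nu0 setT = 1%E by [].
pose nu1 := isMeasure.Build _ _ _ nu0 nu00 nu0_ge0 nu0_sigma.
pose nu2 : {measure set T -> \bar R} := HB.pack nu0 nu1.
pose nu3 := @Measure_isProbability.Build _ _ R nu2 nu01.
pose nu : probability T R := HB.pack nu0 nu1 nu3.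
by exists nu.
Qed.

End density_probability.

(** * The function space as a Gaussian model *)

Section gaussian_setting.
Context {R : realType} (d : nat) (lam : {measure set (d.-tuple R) -> \bar R})
  (D : set (d.-tuple R)) (rho : d.-tuple R -> R)
  (V : normedModType R) (ev : V -> d.-tuple R -> R) (mu : probability (borel V) R).
Hypothesis ok : setting_ok lam D rho ev mu.

Let xi x : borel V -> R := fun f => (ev f \_ D) x.
Let E : set (borel V -> R) := [set L | @lin_fun R V L /\ continuous (L : V -> R)].

Lemma lin_funB (L : V -> R) f g : lin_fun L -> L (f - g) = L f - L g.
Proof. by move=> lL; rewrite addrC -scaleN1r lL mulN1r addrC. Qed.

Lemma lin_fun0 (L : V -> R) : lin_fun L -> L 0 = 0.
Proof. by move=> lL; rewrite -(subrr (0 : V)) lin_funB// subrr. Qed.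

Lemma lin_fun_bounded_continuous (L : V -> R) (K : R) : lin_fun L ->
  (forall f, `|L f| <= K * `|f|) -> continuous L.
Proof.
move=> lL LK f; apply/cvgrPdist_le => e e0.
have K0 : 0 < `|K| + 1 by rewrite ltr_wpDl.
near=> g; rewrite -lin_funB//; apply: le_trans (LK _) _.
apply: (@le_trans _ _ ((`|K| + 1) * `|f - g|)).
  by rewrite ler_wpM2r// (le_trans (ler_norm _))// lerDl.
rewrite -ler_pdivlMl//; near: g.
by apply: cvgr_dist_le => //; rewrite mulr_gt0// invr_gt0.
Unshelve. all: by end_near. Qed.

(** Functions are extended by zero from [D] to the whole space and [nu] has density rho there, so
    norms over [D] become integrals against one probability. Separability gives joint measurability
    of the evaluations, and the embedding makes pairing with a fixed [eta] a continuous
    functional. *)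
Lemma setting_gaussian_model : exists nu : probability (d.-tuple R) R,
  gaussian_model mu nu xi E /\
  forall h : d.-tuple R -> R, measurable_fun D h ->
    G_norm2 lam D rho h = (\int[nu]_x ((h \_ D) x ^+ 2)%:E)%E.
Proof.
have [_ [mD [_ [[mrho [rho0 rho1]] [[S [Sc Sd]] [evlin [_ [evc [[mev [[C evC] _]] gauss]]]]]]]]] := ok.
have mg : measurable_fun setT (rho \_ D) by exact: (measurable_restrictT rho mD).1.
have g0 x : 0 <= (rho \_ D) x.
  by rewrite /patch; case: ifPn => // /set_mem; exact: rho0.
have g1 : (\int[lam]_x ((rho \_ D) x)%:E = 1)%E.
  rewrite -rho1 [RHS]integral_mkcond; apply: eq_integral => x _.
  by rewrite /patch; case: ifP.
have [nu nuE] := density_probability mg g0 g1.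
have G2 (h : d.-tuple R -> R) : measurable_fun D h ->
    G_norm2 lam D rho h = (\int[nu]_x ((h \_ D) x ^+ 2)%:E)%E.
  move=> mh; have mhD : measurable_fun setT (h \_ D) by exact: (measurable_restrictT h mD).1.
  rewrite (@integral_density _ _ _ lam nu _ mg g0 nuE).
  - rewrite /G_norm2 [LHS]integral_mkcond; apply: eq_integral => x _.
    by rewrite /patch; case: ifP => _; rewrite -?EFinM ?expr0n ?mul0e ?mul0r.
  - by apply/measurable_EFinP; exact: measurable_funX.
  - by move=> x; rewrite lee_fin sqr_ge0.
exists nu; split => //.
have evD x : @lin_fun R V (xi x).
  by move=> a f g; rewrite /xi /patch; case: ifP => _; rewrite ?evlin// mulr0 addr0.
have evcD x : continuous (xi x : V -> R).
  rewrite /xi /patch; have [xD|_] := boolP (x \in D); first by apply: evc; exact: set_mem.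
  by move=> f; exact: cvg_cst.
have mevD f : measurable_fun setT (xi^~ f) by apply: (measurable_restrictT (ev f) mD).1.
have mE L : E L -> measurable_fun setT L.
  by move=> [_ cL]; exact: continuous_measurable_borel.
have sE L : E L -> sqint mu L.
  move=> EL; have [lL cL] := EL; have [s [s0 Ls]] := gauss L lL cL.
  exact: (gauss1_sqint s0 (mE _ EL) Ls).
have path f : sqint nu (xi^~ f).
  by split => //; rewrite /xi -G2//; apply: le_lt_trans (evC f) _; rewrite ltry.
have pathC f : dotp nu (xi^~ f) (xi^~ f) <= C ^+ 2 * `|f| ^+ 2.
  by rewrite -lee_fin -integral_sqr// -exprMn /xi -G2.
split => //.
- exact: (@measurable_caratheodory R V _ _ S (fun f x => xi x f) Sc Sd evcD mevD).
- move=> n a e Ee; split.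
    move=> c f g; rewrite mulr_sumr -big_split/=; apply: eq_bigr => i _.
    by have [-> _] := Ee i; ring.
  elim: n a e Ee => [|n IH] a e Ee.
    rewrite (_ : (fun f => _) = (fun=> 0)); last by apply/funext => f; rewrite big_ord0.
    by move=> f; exact: cvg_cst.
  rewrite (_ : (fun f => _) = (fun f => \sum_(i < n) a (widen_ord (leqnSn n) i) *
      e (widen_ord (leqnSn n) i) f + a ord_max * e ord_max f)); last first.
    by apply/funext => f; rewrite big_ord_recr.
  move=> f; apply: cvgD.
    exact: (IH _ (fun i => e (widen_ord (leqnSn n) i)) (fun i => Ee _)).
  by apply: cvgM; [exact: cvg_cst|exact: (proj2 (Ee ord_max))].
- move=> e e' Ee Ee' ee'; have [le ce] := Ee; have [le' ce'] := Ee'.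
  have [s [s0 Ls]] := gauss e le ce; have [s' [s'0 Ls']] := gauss e' le' ce'.
  apply: (gauss1_inj s0 s'0 (mE _ Ee) (mE _ Ee') Ls Ls').
  by rewrite (integral_sqr (sE _ Ee)) (integral_sqr (sE _ Ee')) ee'.
- move=> eta seta.
  have lin : @lin_fun R V (fun w => dotp nu eta (xi^~ w)).
    move=> a f g; rewrite ![dotp nu eta _]dotpC -dotpZl// -dotpDl//; last exact: sqintZ.
    by congr (dotp nu _ _); apply/funext => x; exact: evD.
  split => //; apply: (@lin_fun_bounded_continuous _ (dotp nu eta eta + C ^+ 2)) => // f.
  have [->|f0] := eqVneq f 0; first by rewrite (lin_fun0 lin) !normr0 mulr0.
  have nf : 0 < `|f| by rewrite normr_gt0.
  (* AM-GM: [2 |<eta, f>| <= |f| <eta, eta> + <f, f> / |f|] *)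
  have amgm s : s ^+ 2 = 1 -> 2 * s * dotp nu eta (xi^~ f) <= (dotp nu eta eta + C ^+ 2) * `|f|.
    move=> s2; have sz := sqintZ (s * `|f|) seta.
    have := dotp_ge0 nu (fun x => s * `|f| * eta x - xi x f).
    rewrite (dotpBB sz (path f)) (dotpZl _ seta (path f)) (dotpZl _ seta sz).
    rewrite (dotpC nu eta (fun x => s * `|f| * eta x)) (dotpZl _ seta seta) => H.
    have H2 := pathC f.
    have : 0 <= `|f| * ((dotp nu eta eta + C ^+ 2) * `|f| - 2 * s * dotp nu eta (xi^~ f)).
      apply: le_trans H _; rewrite (_ : s * `|f| * (s * `|f| * dotp nu eta eta) =
        s ^+ 2 * `|f| ^+ 2 * dotp nu eta eta); last by ring.
      by rewrite s2; lra.
    by rewrite pmulr_rge0// subr_ge0.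
  have K0 : 0 <= (dotp nu eta eta + C ^+ 2) * `|f|.
    by rewrite mulr_ge0// addr_ge0 ?dotp_ge0 ?sqr_ge0.
  have := amgm 1 (expr1n _ _); have := amgm (-1) (sqrr_sign _ 1).
  by rewrite ler_norml => ? ?; apply/andP; split; lra.
Qed.

End gaussian_setting.

(** * Comparison of the information complexities *)

Section power_of_standard_information.
Context {R : realType}.

Lemma e_avg_le_nstar (d : nat) (lam : {measure set (d.-tuple R) -> \bar R})
    (D : set (d.-tuple R)) (rho : d.-tuple R -> R) (V : normedModType R)
    (ev : V -> d.-tuple R -> R) (mu : probability (borel V) R)
    crit c (eps : R) N (b : R) :
  (e_avg lam D rho ev mu c N <= eps%:E * CRI lam D rho ev mu crit)%E -> N%:R <= b ->
  exists n : nat, is_nstar lam D rho ev mu crit c eps n /\ n%:R <= b.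
Proof.
move=> eN Nb.
have ex : exists n, `[< (e_avg lam D rho ev mu c n <= eps%:E * CRI lam D rho ev mu crit)%E >].
  by exists N; apply/asboolP.
have [n /asboolP en nmin] := ex_minnP ex.
exists n; split; first by split => // k ek; apply: nmin; apply/asboolP.
by apply: le_trans Nb; rewrite ler_nat nmin//; apply/asboolP.
Qed.

(** The factor A^2 between the two squared error levels is spent twice: B^2 pays for an algorithm
    that only nearly attains the infimum over [Lall], and 1 + th for replacing its functionals by
    samples. *)
Lemma std_le_all (A om : R) : 1 < A -> 0 < om -> exists C : R, 0 < C /\
  forall (d : nat) (lam : {measure set (d.-tuple R) -> \bar R})
    (D : set (d.-tuple R)) (rho : d.-tuple R -> R) (V : normedModType R)
    (ev : V -> d.-tuple R -> R) (mu : probability (borel V) R),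
  setting_ok lam D rho ev mu -> forall crit (eps : R), 0 < eps ->
  forall m : nat, is_nstar lam D rho ev mu crit Lall (eps / A) m ->
  exists n : nat, is_nstar lam D rho ev mu crit Lstd eps n /\
    n%:R <= C * (m%:R + 1) `^ (1 + om).
Proof.
move=> A1 om0; have A0 : 0 < A by lra.
pose B := (1 + A) / 2.
have B1 : 1 < B by rewrite /B; lra.
have BA : B < A by rewrite /B; lra.
have AB : 1 < (A / B) ^+ 2 by rewrite exprn_egt1// ltr_pdivlMr ?mul1r; lra.
(* The largest th allowed by both (1 + th) B^2 <= A^2 and the range of [evaluation_algorithm]. *)
pose th := Num.min 1 ((A / B) ^+ 2 - 1).
have th01 : 0 < th <= 1 by rewrite lt_min ltr01 subr_gt0 AB ge_min lexx.
have thAB : (1 + th) * B ^+ 2 <= A ^+ 2.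
  have : 1 + th <= (A / B) ^+ 2 by rewrite -lerBrDl ge_min lexx orbT.
  by rewrite expr_div_n ler_pdivlMr// exprn_gt0//; lra.
have [C [C0 HC]] := evaluation_algorithm om0 th01.
exists C; split => // d lam D rho V ev mu ok crit eps eps0 m [em _].
have Cb0 : 0 <= C * (m%:R + 1) `^ (1 + om) by rewrite mulr_ge0 ?powR_ge0// ltW.
suff [N [NC eN]] : exists N : nat, N%:R <= C * (m%:R + 1) `^ (1 + om) /\
    (e_avg lam D rho ev mu Lstd N <= eps%:E * CRI lam D rho ev mu crit)%E.
  exact: e_avg_le_nstar eN NC.
have e0 c : e_avg lam D rho ev mu c 0 = sqrte (Gamma lam D rho ev mu) by [].
have triv : (sqrte (Gamma lam D rho ev mu) <= eps%:E * CRI lam D rho ev mu crit)%E ->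
    exists N : nat, N%:R <= C * (m%:R + 1) `^ (1 + om) /\
    (e_avg lam D rho ev mu Lstd N <= eps%:E * CRI lam D rho ev mu crit)%E.
  by move=> G; exists 0%N; split => //; rewrite e0.
have CRI0 : (0 <= CRI lam D rho ev mu crit)%E by case: crit {em triv}; rewrite /= ?sqrte_ge0.
(* An infinite [CRI] is met by the zero algorithm. A zero [CRI] occurs only for [NOR], where it says
   that the zero algorithm has no error. *)
have [Cy|Cy] := eqVneq (CRI lam D rho ev mu crit) +oo%E.
  by apply: triv; rewrite Cy gt0_muley ?lte_fin// leey.
have [Cz|Cz] := eqVneq (CRI lam D rho ev mu crit) 0%E.
  apply: triv; rewrite Cz mule0; move: Cz; case: crit {em CRI0 Cy} => /= [/eqP|->//].
  by rewrite eqe oner_eq0.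
have [c cE c0] : exists2 c : R, CRI lam D rho ev mu crit = c%:E & 0 < c.
  have Cf : CRI lam D rho ev mu crit \is a fin_num by rewrite ge0_fin_numE// ltey.
  exists (fine (CRI lam D rho ev mu crit)); rewrite ?fineK//.
  by rewrite fine_gt0// lt_neqAle eq_sym Cz CRI0 ltey.
have ec0 : 0 < eps * c by exact: mulr_gt0.
rewrite cE -EFinM in em; rewrite cE -EFinM.
(* For m = 0 both classes use the same zero algorithm, and eps / A is at most eps. *)
have [m0|m0] := posnP m.
  subst m; move: triv; rewrite cE -EFinM; apply; rewrite -(e0 Lall); apply: le_trans em _.
  by rewrite lee_fin mulrAC ler_pdivrMr// ler_peMr// ltW.
move: em; rewrite /e_avg gt_eqF// => em.
have : (ereal_inf [set r | exists (L : 'I_m -> V -> R) (phi : m.-tuple R -> d.-tuple R -> R),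
    (forall i, in_class D ev Lall (L i)) /\ meas_phi phi /\
    r = sqrte (err2 lam D rho ev mu L phi)] < (eps / A * c * B)%:E)%E.
  by apply: le_lt_trans em _; rewrite lte_fin ltr_pMr// mulr_gt0// divr_gt0.
move=> /ereal_inf_lt [_ [L [phi [EL [mphi ->]]]] errlt].
pose s := (eps / A * c * B) ^+ 2.
have err_s : (err2 lam D rho ev mu L phi < s%:E)%E.
  rewrite ltNge; apply: contraTN errlt => serr; rewrite -leNgt.
  have <- : sqrte s%:E = (eps / A * c * B)%:E.
    have B0 : 0 < B by lra.
    by rewrite /= sqrtr_sqr gtr0_norm// mulr_gt0// mulr_gt0// divr_gt0.
  rewrite lee_sqrt//; apply: integral_ge0 => f _; apply: integral_ge0 => x Dx.
  rewrite lee_fin mulr_ge0 ?sqr_ge0//.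
  by have [_ [_ [_ [[_ [rho0 _]] _]]]] := ok; exact: rho0.
have [nu [gm G2]] := setting_gaussian_model ok.
have [_ [mD [_ [_ [_ [_ [_ [_ [[mev _] _]]]]]]]]] := ok.
have err2E n (K : 'I_n -> V -> R) (psi : n.-tuple R -> d.-tuple R -> R) : meas_phi psi ->
    err2 lam D rho ev mu K psi =
    (\int[mu]_f \int[nu]_x (((ev f \_ D) x - (psi [tuple K i f | i < n] \_ D) x) ^+ 2)%:E)%E.
  move=> mpsi; apply: eq_integral => f _; rewrite G2.
    by apply: eq_integral => x _; rewrite /patch; case: ifP; rewrite ?subr0.
  apply: measurable_funB; first exact: mev.
  by apply: measurable_funTS; exact: (measurableT_comp mpsi (pair1_measurable _)).
have patch_meas n (psi : n.-tuple R -> d.-tuple R -> R) : meas_phi psi ->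
    measurable_fun setT (fun q : n.-tuple R * d.-tuple R => (psi q.1 \_ D) q.2).
  move=> mpsi; rewrite (_ : (fun q => _) =
      (fun q : n.-tuple R * d.-tuple R => psi q.1 q.2 * \1_D q.2)); last first.
    apply/funext => q; rewrite /patch indicE; case: (q.2 \in D); by rewrite ?mulr1 ?mulr0.
  apply: measurable_funM => //.
  apply: (measurableT_comp (f := \1_D : d.-tuple R -> R)) => //; exact: measurable_snd.
rewrite err2E// in err_s.
have xiD x f : ~ D x -> (ev f \_ D) x = 0 by move=> nD; rewrite /patch memNset.
have [N [pts [psi [psi0 [NC Dpts mpsi psi_le]]]]] :=
  HC _ (borel V) mu _ _ nu (fun x f => (ev f \_ D) x) _ D m L (fun t => phi t \_ D) s gm xiD EL (patch_meas _ _ mphi) err_s.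
exists N; split => //.
have s_le : (1 + th) * s <= (eps * c) ^+ 2.
  rewrite /s (_ : _ * _ = (1 + th) * B ^+ 2 * (eps * c) ^+ 2 / A ^+ 2); last first.
    by field; rewrite gt_eqF.
  rewrite ler_pdivrMr ?exprn_gt0// mulrC.
  by rewrite ler_pM2l ?exprn_gt0.
have sq (x : \bar R) : (x <= ((eps * c) ^+ 2)%:E)%E -> (sqrte x <= (eps * c)%:E)%E.
  have <- : sqrte ((eps * c) ^+ 2)%:E = (eps * c)%:E by rewrite /= sqrtr_sqr gtr0_norm.
  by rewrite lee_sqrt ?lee_fin ?sqr_ge0.
have psi_le' := le_trans psi_le (_ : _ <= ((eps * c) ^+ 2)%:E)%E.
have {}psi_le' := psi_le' s_le.
(* [e_avg] at 0 is defined through [Gamma] and not as an infimum; it agrees with the error of [psi],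
   which is zero here. *)
have [N0|N0] := eqVneq N 0%N.
  apply: sq; apply: le_trans psi_le'; rewrite le_eqVlt; apply/orP; left; apply/eqP.
  apply: eq_integral => f _; rewrite G2//.
  by apply: eq_integral => x _; rewrite psi0 ?subr0//; left.
apply: (@le_trans _ _ (sqrte (err2 lam D rho ev mu (fun i f => ev f (pts i)) psi))).
  apply: ereal_inf_lbound; exists (fun i f => ev f (pts i)), psi; split => //.
  by move=> i; exists (pts i).
apply: sq; rewrite (err2E _ _ _ mpsi); apply: le_trans psi_le'; rewrite le_eqVlt; apply/orP; left; apply/eqP.
apply: eq_integral => f _; apply: eq_integral => x _.
have -> : [tuple (ev f \_ D) (pts i) | i < N] = [tuple ev f (pts i) | i < N].
  by apply: eq_from_tnth => i; rewrite !tnth_mktuple /patch mem_set.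
by rewrite [X in _ - X]/patch; case: ifPn => // /negP nD; rewrite psi0//; right => /mem_set.
Qed.

(** ln(1/delta) is positive on (0, 1), so the first factor exceeds 1, and the second is at least
    1. *)
Lemma A_delta_gt1 (delta : R) : 0 < delta < 1 -> 1 < A_delta delta.
Proof.
move=> /andP[d0 d1].
have l0 : 0 < ln (1 / delta) by rewrite ln_gt0// ltr_pdivlMr// mul1r.
have s1 : 1 < Num.sqrt (1 + 1 / (12 * ln (1 / delta))).
  by rewrite -[ltLHS]sqrtr1 ltr_sqrt ?ltrDl ?divr_gt0 ?mulr_gt0// ltr_wpDr// divr_ge0// mulr_ge0// ltW.
have s2 : 1 <= 1 / Num.sqrt (1 - delta).
  rewrite ler_pdivlMr ?sqrtr_gt0 ?subr_gt0// mul1r -[leRHS]sqrtr1 ler_wsqrtr//; lra.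
rewrite /A_delta; apply: lt_le_trans s1 _; rewrite ler_peMr//.
Qed.

End power_of_standard_information.

Theorem theorem2p2 (R : realType) (crit : criterion) :
  (forall omega : R, 0 < omega ->
    exists C : R, 0 < C /\
      forall (d : nat) (lam : {measure set (d.-tuple R) -> \bar R})
        (D : set (d.-tuple R)) (rho : d.-tuple R -> R)
        (V : completeNormedModType R) (ev : V -> d.-tuple R -> R)
        (mu : probability (borel V) R),
      (0 < d)%N -> setting_ok lam D rho ev mu ->
      forall eps : R, 0 < eps < 1 ->
      forall m_all : nat, is_nstar lam D rho ev mu crit Lall (eps / 4) m_all ->
      exists m_std : nat, is_nstar lam D rho ev mu crit Lstd eps m_std /\
        m_std%:R <= C * (m_all%:R + 1) `^ (1 + omega))
  /\
  (exists omega0 delta0 : R, 0 < omega0 /\ 0 < delta0 /\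
    forall omega delta : R, 0 < omega < omega0 -> 0 < delta < delta0 ->
    exists C : R, 0 < C /\
      forall (d : nat) (lam : {measure set (d.-tuple R) -> \bar R})
        (D : set (d.-tuple R)) (rho : d.-tuple R -> R)
        (V : completeNormedModType R) (ev : V -> d.-tuple R -> R)
        (mu : probability (borel V) R),
      (0 < d)%N -> setting_ok lam D rho ev mu ->
      forall eps : R, 0 < eps < 1 ->
      forall m_all : nat,
        is_nstar lam D rho ev mu crit Lall (eps / A_delta delta) m_all ->
      exists m_std : nat, is_nstar lam D rho ev mu crit Lstd eps m_std /\
        m_std%:R <= C * (m_all%:R + 1) `^ (1 + omega)).
Proof.
split.
  move=> omega om0; have A1 : (1 : R) < 4 by rewrite ltr1n.
  have [C [C0 H]] := std_le_all A1 om0.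
  exists C; split => // d lam D rho V ev mu _ ok eps /andP[eps0 _] m.
  exact: H.
(* delta < 1 keeps both ln(1/delta) and 1 - delta positive; for omega any positive threshold would
   do. *)
exists 1, 1; split => //; split => // omega delta /andP[om0 _] d01.
have [C [C0 H]] := std_le_all (A_delta_gt1 d01) om0.
exists C; split => // d lam D rho V ev mu _ ok eps /andP[eps0 _] m.
exact: H.
Qed.
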